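(* Let $f(z)=\sum_{k=0}^\infty a_k z^k$, with $a_k>0$ for all $k\ge 0$, be an entire function, and for $n\ge 2$ put $q_n(f)=\frac{a_{n-1}^2}{a_{n-2}a_n}$. Suppose that there are real numbers $a,b$ with $1<a<b$ such that $q_2(f)=q_4(f)=q_6(f)=\ldots=a$ and $q_3(f)=q_5(f)=q_7(f)=\ldots=b$. Suppose that there exists $z_0\in\left[-\frac{a_1}{a_2},0\right]$ such that $f(z_0)\le 0$ (for example, this condition is fulfilled if $3\le a<4$ and $a<b\le\frac{8}{a(4-a)}$). Then the sequence $(k!\,a_k)_{k=0}^\infty$ is a multiplier sequence and the sequence $(f(k))_{k=0}^\infty$ is a complex zero decreasing sequence.
   Context: A sequence $(\gamma_k)_{k=0}^\infty$ of real numbers is called a multiplier sequence if, whenever a real polynomial $P(z)=\sum_{k=0}^n c_k z^k$ has only real zeros, the polynomial $\sum_{k=0}^n\gamma_k c_k z^k$ has only real zeros. For a real polynomial $P$, let $Z_{\mathbb{C}}(P)$ denote the number of nonreal zeros of $P$ counting multiplicities. A sequence $(\gamma_k)_{k=0}^\infty$ of real numbers is called a complex zero decreasing sequence if $Z_{\mathbb{C}}\left(\sum_{k=0}^n\gamma_k c_k z^k\right)\le Z_{\mathbb{C}}\left(\sum_{k=0}^n c_k z^k\right)$ for any real polynomial $\sum_{k=0}^n c_k z^k$. *)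

(* Defs.v *)
From HB Require Import structures.
From mathcomp Require Import all_boot all_order all_algebra.
From mathcomp Require Import all_classical all_reals all_analysis.
From mathcomp Require Export complex.

Set Implicit Arguments.
Unset Strict Implicit.
Unset Printing Implicit Defensive.

Import Order.TTheory GRing.Theory Num.Theory.
Import numFieldNormedType.Exports.

Local Open Scope classical_set_scope.
Local Open Scope complex_scope.
Local Open Scope ring_scope.

(* A power series converging at every point of the complex plane is the same
   thing as the Taylor expansion at 0 of an entire function.  [R[i]^o] is the
   type [R[i]] with the topology given by its modulus. *)
Definition entire_with_coeffs (R : realType) (a : nat -> R)
    (f : R[i]^o -> R[i]^o) : Prop :=
  forall z : R[i]^o, series (fun k => (a k)%:C * z ^+ k : R[i]^o) @ \oo --> f z.

(* Only meaningful for [2 <= n]. *)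
Definition second_quotient (R : realType) (a : nat -> R) (n : nat) : R :=
  a n.-1 ^+ 2 / (a n.-2 * a n).

Definition complexify (R : realType) (P : {poly R}) : {poly R[i]} :=
  map_poly (real_complex R) P.

Definition diag_op (R : realType) (gamma : nat -> R) (P : {poly R}) : {poly R} :=
  \poly_(k < size P) (gamma k * P`_k).

(* The zero polynomial, which a sequence with vanishing terms can produce, is
   by convention counted as having only real zeros. *)
Definition only_real_zeros (R : realType) (P : {poly R}) : Prop :=
  P = 0 \/ forall z : R[i], root (complexify P) z -> z \is Num.real.

Definition multiplier_sequence (R : realType) (gamma : nat -> R) : Prop :=
  forall P : {poly R}, only_real_zeros P -> only_real_zeros (diag_op gamma P).

(* [closed_field_poly_normal] gives the list of all complex roots, each one
   repeated according to its multiplicity.  The zero polynomial is assigned the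
   value 0, consistently with [only_real_zeros]. *)
Definition num_nonreal_zeros (R : realType) (P : {poly R}) : nat :=
  if P == 0 then 0%N else
  count (fun z : R[i] => z \isn't Num.real)
        (sval (closed_field_poly_normal (complexify P))).

Definition complex_zero_decreasing_sequence (R : realType)
    (gamma : nat -> R) : Prop :=
  forall P : {poly R},
    (num_nonreal_zeros (diag_op gamma P) <= num_nonreal_zeros P)%N.

(* Main.v *)
Require Import Defs.
From HB Require Import structures.
From mathcomp Require Import all_boot all_order all_algebra.
From mathcomp Require Import all_classical all_reals all_analysis.
From mathcomp Require Import complex polyrcf ring lra zify.

Set Implicit Arguments.
Unset Strict Implicit.
Unset Printing Implicit Defensive.

Import Order.TTheory GRing.Theory Num.Theory.
Import numFieldNormedType.Exports.

Local Open Scope classical_set_scope.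
Local Open Scope complex_scope.
Local Open Scope ring_scope.

(** The function [f] has only negative zeros, in the strong sense that it is a limit of
    polynomials with only negative zeros; both conclusions are classical
    consequences of that.

    The polynomials
    Put [r_k = a_k / a_(k+1)], so that [r_(k+1) = r_k * a] or [r_k * b] according to
    the parity of [k].  For [r_(k-1) <= t <= r_k] the term of index [k] dominates in
    the alternating sum [f (- t)].  With [C = r_k / r_(k-1)] and [t] the geometric mean
    of [r_(k-1)] and [r_k], the terms at distance 1, 2 and 3 from it have relative
    sizes [C^(-1/2)], [1 / (a b)] and [C^(-1/2) / (a b)^2], so [f (- t)] has the sign
    [(-1)^k] as soon as [1 - 2 / sqrt C] exceeds minus a fixed part of [2 / (a b)].
    The worst case is [C = a].  Now [f z0 <= 0] makes the sum of the first
    four terms negative at [z0]; this forces [a > 3] ([cubic_neg_gt3]) and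
    [1 - 2 / sqrt a + 3 / (2 a b) > 0] ([cubic_neg_bound]), which is just enough.
    Only near the index 1, where there is a single term on the left, does this
    argument fail, and there the point [z0] itself is used.  At the other end
    of a polynomial the same difficulty arises; it is removed by multiplying the
    leading coefficient of the partial sum of even degree [n] by 2/3 ([damped_sum]).
    The result is a polynomial of degree [n] with [n] changes of sign on the
    negative half-line ([damped_sum_negative_rooted]).

    Multiplier sequences
    For [phi = c * prod (X + al_j)] with [al_j > 0] and a polynomial [P] with only real
    zeros, the operator [phi (w D)] is a product of factors [al_j + w D].  When
    [Im w >= 0] each factor preserves the absence of zeros in the upper half-plane,
    by the formula for [p' / p].  Reading [(phi (w D) P)(z)] as a polynomial in [w]
    and letting [z] tend to 0 yields the polynomial with coefficients
    [k! * phi_k * P_k].  The limits, in [z] and in [phi], are harmless because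
    the absence of zeros in the upper half-plane means that [|p (x + i y)|]
    increases with [y >= 0], a condition closed under pointwise limits.

    Complex zero decreasing sequences
    For the same [phi], multiplying the coefficients of [P] by [phi k] amounts to
    applying the operators [al_j + X D], and none of them decreases the number of
    real zeros: this is Rolle's theorem for [|x|^al * P] ([laguerre_step]).  The
    number of real zeros is upper semicontinuous as long as the degree is
    constant ([ultra_lim_real_roots]), so [phi] may be replaced by its limit [f].

    The explicit sufficient condition for [z0] to exist comes from the partial sum of
    degree 4, which becomes a quadratic polynomial in [y + 1 / y] after a rescaling
    ([quartic_nonpos]). *)

(** * Real zeros of [al P + X P'] *)

(** The points found in the gaps are distinct because the [ts] separate them. *)
Lemma gap_selection (R : realType) (Z : R -> Prop) (x0 : R) (ts : seq R) :
  path <%R x0 ts ->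
  (forall i, (i < size ts)%N ->
     exists2 c, nth 0 (x0 :: ts) i < c < nth 0 ts i & Z c) ->
  exists cs : seq R, [/\ size cs = size ts, path <%R x0 cs &
    forall c, c \in cs -> Z c /\ c \notin x0 :: ts].
Proof.
elim: ts x0 => [|t ts IH] x0 /=; first by move=> _ _; exists [::].
move=> /andP[x0t tts] gap.
have [i i_lt|cs [szcs pcs csP]] := IH t tts; first exact: (gap i.+1).
have [c /= /andP[x0c ct] Zc] := gap 0%N isT.
have tlt := order_path_min lt_trans tts.
have tlc := order_path_min lt_trans pcs.
exists (c :: cs); split => [|/=|d]; first by rewrite /= szcs.
  rewrite x0c; case: cs pcs {szcs csP tlc} => //= d cs /andP[td ->].
  by rewrite andbT; exact: lt_trans td.
rewrite inE => /predU1P[->|dcs].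
  split=> //; rewrite !inE !negb_or gt_eqF// lt_eqF//=.
  by apply/negP => /(allP tlt) /(lt_trans ct); rewrite ltxx.
have [Zd dn] := csP d dcs; split=> //; rewrite inE negb_or dn andbT.
by rewrite gt_eqF// (lt_trans x0t)// (allP tlc).
Qed.

(** Rolle's theorem for [x `^ al * P], whose derivative is [x `^ (al - 1)] times
    [al P + x P']; this function also vanishes at 0, whatever [P] is. *)
Lemma weighted_rolle_pos (R : realType) (al : R) (P : {poly R}) (l r : R) :
  0 < al -> 0 <= l < r -> (l = 0 \/ root P l) -> root P r ->
  exists2 c, l < c < r & root (al *: P + 'X * P^`()) c.
Proof.
move=> al0 /andP[l0 lr] Pl Pr.
pose h (x : R) := x `^ al * P.[x].
have dh (x : R) : 0 < x -> is_derive x (1 : R) h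
    (x `^ al *: P^`().[x] + P.[x] *: (al * x `^ (al - 1))).
  by move=> x0; apply: is_deriveM; exact: is_derive1_powR.
have ch (x : R) : 0 < x -> {for x, continuous h}.
  move=> x0; apply/differentiable_continuous/derivable1_diffP.
  by have [] := dh x x0.
have [|||c] := @Rolle R h l r lr.
- move=> x; rewrite in_itv/= => /andP[lx _].
  by have [] := dh x (le_lt_trans l0 lx).
- apply/continuous_within_itvP => //; split.
  + move=> x; rewrite in_itv/= => /andP[lx _].
    exact: ch (le_lt_trans l0 lx).
  + move: l0; rewrite le_eqVlt => /predU1P[l0|l0].
      rewrite -l0 /h powR0 ?gt_eqF//; apply: cvgM; first exact: powR_cvg0.
      by apply: cvg_at_right_filter; exact: continuous_horner.
    by apply: cvg_at_right_filter; exact: ch.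
  + by apply: cvg_at_left_filter; apply: ch; exact: le_lt_trans lr.
- rewrite /h (rootP Pr) mulr0; case: Pl => [->|/rootP ->]; last by rewrite mulr0.
  by rewrite powR0 ?gt_eqF// mul0r.
rewrite in_itv/= => /andP[lc cr] [_ dc]; exists c; first by rewrite lc.
have c0 : 0 < c by exact: le_lt_trans lc.
have [_] := dh c c0; rewrite dc.
have -> : c `^ (al - 1) = c `^ al / c.
  rewrite powRB; first by rewrite powRr1 ?ltW.
  by rewrite (gt_eqF c0) implybT.
move=> dcE; apply/rootP; rewrite !hornerE.
have cal : c `^ al / c != 0 by rewrite mulf_neq0 ?invr_neq0 ?gt_eqF ?powR_gt0.
apply: (mulfI cal); rewrite mulr0 [RHS]dcE /GRing.scale /=.
by field; rewrite gt_eqF.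
Qed.

Lemma weighted_rolle (R : realType) (al : R) (P : {poly R}) (l r : R) :
  0 < al -> l < r -> 0 <= l \/ r <= 0 -> (l = 0 \/ root P l) ->
  (r = 0 \/ root P r) ->
  exists2 c, l < c < r & root (al *: P + 'X * P^`()) c.
Proof.
move=> al0 lr [l0|r0] Pl Pr.
  apply: weighted_rolle_pos => //; first by rewrite l0.
  by case: Pr => // r0; move: lr; rewrite r0 ltNge l0.
pose N : {poly R} := P \Po (- 'X).
have NE x : root P x -> root N (- x).
  by rewrite /root horner_comp hornerN hornerX opprK.
have [|||c crl] := @weighted_rolle_pos R al N (- r) (- l) al0.
- by rewrite oppr_ge0 r0 ltrN2.
- by case: Pr => [->|/NE]; [left; rewrite oppr0|right].
- by case: Pl => [l0|/NE//]; move: lr; rewrite l0 ltNge r0.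
rewrite /root deriv_comp !hornerE horner_comp horner_comp derivN derivX !hornerE.
move=> /eqP QP; exists (- c); first by rewrite ltrNl andbC ltrNr.
by rewrite /root !hornerE; apply/eqP; rewrite -[RHS]QP /= mulrN1 mulNr.
Qed.

(** Each simple pole of the logarithmic derivative of [\prod_(r <- t) ('X - r)]
    is cancelled by a zero of [G]. *)
Lemma dvdp_mul_deriv_prod_XsubC (R : realType) (t : seq R) (G : {poly R}) :
  (forall r, r \in t -> root G r) ->
  \prod_(r <- t) ('X - r%:P) %| G * (\prod_(r <- t) ('X - r%:P))^`().
Proof.
elim: t => [|r t IH] Gt; first by rewrite big_nil derivC mulr0 dvdp0.
rewrite big_cons derivM derivXsubC mul1r mulrDr; apply: dvdp_add.
  by apply: dvdp_mul; rewrite ?dvdpp// dvdp_XsubCl Gt ?mem_head.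
rewrite mulrCA dvdp_mul// IH// => s st.
by apply: Gt; rewrite inE st orbT.
Qed.

Lemma uniq_sub_perm_cat (T : eqType) (u s : seq T) :
  uniq u -> {subset u <= s} -> exists s1, perm_eq s (u ++ s1).
Proof.
elim: u s => [|x u IH] s /=; first by exists s.
move=> /andP[xu uu] us.
have [|s1 s1P] := IH (rem x s) uu.
  move=> y yu; have := us y; rewrite inE yu orbT => /(_ isT).
  rewrite (perm_mem (perm_to_rem (us x (mem_head _ _)))) inE.
  by case/predU1P=> // yx; rewrite -yx yu in xu.
exists s1; rewrite (perm_trans (perm_to_rem (us x (mem_head _ _))))//.
by rewrite perm_cons.
Qed.

(** Laguerre: between two neighbouring elements of the set formed by 0 and the
    given zeros, Rolle's theorem provides a new zero; it makes up for the one
    lost in the multiplicity of each nonzero zero, the multiplicity of 0 being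
    preserved. *)
Lemma laguerre_step (R : realType) (al : R) (P : {poly R}) (s : seq R) :
  0 < al -> \prod_(r <- s) ('X - r%:P) %| P ->
  exists2 s' : seq R, size s' = size s &
    \prod_(r <- s') ('X - r%:P) %| al *: P + 'X * P^`().
Proof.
move=> al0 sP; pose Q := al *: P + 'X * P^`().
(* [u] holds the zeros other than 0, once each; [s1] keeps the remaining copies,
   which divide [al P + X P'] as well *)
pose u := undup [seq r <- s | r != 0].
have u0 : 0 \notin u by rewrite mem_undup mem_filter eqxx.
have us : {subset u <= s}.
  by move=> r; rewrite mem_undup mem_filter => /andP[].
have [s1 s1P] := uniq_sub_perm_cat (undup_uniq _) us.
have s1u r : r \in s1 -> r = 0 \/ r \in u.
  move=> rs1; have [->|r0] := eqVneq r 0; [by left|right].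
  by rewrite mem_undup mem_filter r0 (perm_mem s1P) mem_cat rs1 orbT.
have /dvdpP[W PE] := sP; rewrite (perm_big _ s1P)/= big_cat/= mulrA in PE.
set A := W * _ in PE.
have Au r : r \in u -> root A r.
  by move=> ru; rewrite rootM root_prod_XsubC ru orbT.
have Pu r : r \in u -> root P r by move=> ru; rewrite PE rootM Au.
have /dvdpP[Q1 QE] : \prod_(r <- s1) ('X - r%:P) %| Q.
  rewrite /Q PE derivM; apply: dvdp_add; first by rewrite dvdpZr ?gt_eqF// dvdp_mull.
  rewrite mulrDr dvdp_add//; first by rewrite mulrA dvdp_mull.
  rewrite mulrA dvdp_mul_deriv_prod_XsubC// => r /s1u[->|ru].
    by rewrite rootM rootX eqxx.
  by rewrite rootM Au ?orbT.
(* 0 is included so that no gap contains it *)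
pose d := sort <=%R (0 :: u).
have dmem x : (x \in d) = (x == 0) || (x \in u) by rewrite mem_sort inE.
have dlt : sorted <%R d by rewrite sort_lt_sorted /= u0 undup_uniq.
have szd : size d = (size u).+1 by rewrite size_sort.
case dE : d dmem dlt szd => [//|x0 ts] dmem dlt [szts].
have [|cs [szcs pcs csP]] := @gap_selection R (root Q) x0 ts dlt.
  move=> i i_lt; set l := nth 0 _ i; set r := nth 0 _ i.
  have lr : l < r by exact: (pathP 0 dlt).
  have ld : l \in x0 :: ts by apply: mem_nth; exact: ltnW.
  have rd : r \in x0 :: ts by rewrite inE mem_nth ?orbT.
  have rootd x : x \in x0 :: ts -> x = 0 \/ root P x.
    by rewrite dmem => /predU1P[->|/Pu]; [left|right].
  apply: weighted_rolle => //; [|exact: rootd..].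
  have [l0|l0] := leP 0 l; [by left|right].
  rewrite leNgt; apply/negP => r0.
  have d0 : 0 \in x0 :: ts by rewrite dmem eqxx.
  have := nth_index 0 d0; set j := index _ _ => jE.
  have jlt : (j < (size ts).+1)%N by rewrite -[(size ts).+1]/(size (x0 :: ts)) index_mem.
  have ij : (i < j)%N.
    by rewrite -(lt_sorted_ltn_nth 0 dlt) ?inE ?jE//= ltnS ltnW.
  have : (j < i.+1)%N.
    by rewrite -(lt_sorted_ltn_nth 0 dlt) ?inE ?jE.
  by rewrite ltnS leqNgt ij.
exists (cs ++ s1).
  by rewrite size_cat szcs szts (perm_size s1P) size_cat.
rewrite big_cat /= -/Q QE dvdp_mul2r; last by rewrite monic_neq0 ?monic_prod_XsubC.
apply: uniq_roots_dvdp; last first.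
  by rewrite uniq_rootsE (sorted_uniq lt_trans ltxx (path_sorted pcs)).
apply/allP => c /csP[]; rewrite QE rootM root_prod_XsubC => /orP[//|cs1].
by rewrite dmem; case: (s1u c cs1) => [->|->]; rewrite ?eqxx ?orbT.
Qed.

(** * Counting nonreal zeros and passing to the limit *)

(** Turns a bound on the number of nonreal zeros into the divisibility by a product
    of real linear factors, a form which does not refer to a list of all zeros. *)
Lemma nonreal_zeros_leP (R : realType) (P : {poly R}) (m : nat) : P != 0 ->
  (num_nonreal_zeros P <= m)%N <->
  exists2 s : seq R, ((size P).-1 <= size s + m)%N &
    \prod_(r <- s) ('X - r%:P) %| P.
Proof.
move=> P0; rewrite /num_nonreal_zeros (negPf P0).
case: closed_field_poly_normal => zs /= zsE.
have szC (p : {poly R}) : size (complexify p) = size p by exact: size_map_poly.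
have cP0 : complexify P != 0 by rewrite -size_poly_eq0 szC size_poly_eq0.
have prodC (s : seq R) : complexify (\prod_(r <- s) ('X - r%:P)) =
    \prod_(z <- [seq r%:C | r <- s]) ('X - z%:P).
  rewrite /complexify rmorph_prod big_map; apply: eq_bigr => r _.
  by rewrite /= rmorphB /= map_polyX map_polyC.
have szP : (size P).-1 = size zs.
  by rewrite -szC zsE size_scale ?lead_coef_eq0// size_prod_XsubC.
rewrite szP; split => [zm|[s szs /dvdpP[W PE]]].
  pose s := [seq complex.Re z | z <- zs & z \is Num.real].
  exists s.
    rewrite size_map size_filter -(count_predC (fun z => z \is Num.real) zs).
    by rewrite leq_add2l.
  rewrite -(dvdp_map (real_complex R)) -/(complexify _) -/(complexify _) prodC.
  rewrite -map_comp zsE dvdpZr ?lead_coef_eq0//.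
  rewrite (eq_in_map _ id _).1 ?map_id; last first.
    by move=> z; rewrite mem_filter => /andP[zR _]; exact: RRe_real.
  by rewrite big_filter [X in _ %| X](bigID (fun z => z \is Num.real)) dvdp_mulr.
have W0 : W != 0 by apply: contraNneq P0 => W0; rewrite PE W0 mul0r.
have [ws wsE] := closed_field_poly_normal (complexify W).
have cPE : complexify P = complexify W * \prod_(z <- [seq r%:C | r <- s]) ('X - z%:P).
  by rewrite -prodC -[RHS]rmorphM -PE.
have lE : lead_coef (complexify P) = lead_coef (complexify W).
  by rewrite cPE lead_coefM (monicP (monic_prod_XsubC _ _ _)) mulr1.
have zP : perm_eq zs (ws ++ [seq r%:C | r <- s]).
  apply: prod_XsubC_eq; rewrite big_cat /=.
  apply: (@scalerI _ _ (lead_coef (complexify P))); first by rewrite lead_coef_eq0.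
  by rewrite -zsE scalerAl lE -wsE.
have szzs := perm_size zP; rewrite size_cat size_map in szzs.
have s0 : count (fun z : R[i] => z \isn't Num.real) [seq r%:C | r <- s] = 0%N.
  apply/eqP; rewrite eqn0Ngt -has_count; apply/hasPn => _ /mapP[r _ ->].
  by rewrite negbK; apply/complex_realP; exists r.
rewrite (permP zP) count_cat s0 addn0.
apply: leq_trans (count_size _ _) _.
by rewrite szzs addnC leq_add2l in szs.
Qed.

Lemma ultra_bounded_cvg (R : realType) (U : set_system nat) (u : nat -> R) (B : R) :
  UltraFilter U -> (\forall N \near U, `|u N| <= B) ->
  exists l : R, u N @[N --> U] --> l.
Proof.
move=> UU uB.
have cB := @segment_compact R (- B) B.
have FB : (u @ U) `[- B, B]%classic.
  by apply: filterS uB => N /=; rewrite in_itv/= ler_norml.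
have [l [_ lcl]] := cB _ _ FB.
exists l => V Vl; case: (in_ultra_setVsetC (u @^-1` V) UU) => // UnV.
have [//|x []] := lcl (~` V) V _ Vl.
by [].
Qed.

(** Along an ultrafilter bounded sequences converge, and zeros of polynomials of
    fixed degree stay bounded as long as the leading coefficient does not tend
    to 0; so real zeros may be split off one at a time, before and after taking
    the limit. *)
Lemma ultra_lim_real_roots (R : realType) (U : set_system nat)
    (PN : nat -> {poly R}) (P : {poly R}) (n p : nat) :
  UltraFilter U -> (forall N, (size (PN N) <= n.+1)%N) ->
  (forall i, (PN N)`_i @[N --> U] --> P`_i) -> P`_n != 0 ->
  (forall N, exists2 s : seq R, size s = p & \prod_(r <- s) ('X - r%:P) %| PN N) ->
  exists2 s : seq R, size s = p & \prod_(r <- s) ('X - r%:P) %| P.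
Proof.
move=> UU; elim: p n PN P => [|p IH] n PN P szPN cvP Pn0 PNs.
  by exists [::]; rewrite // big_nil dvd1p.
have /choice[rQ rQP] : forall N, exists rQ : R * {poly R},
    PN N = ('X - rQ.1%:P) * rQ.2 /\
    exists2 s : seq R, size s = p & \prod_(r <- s) ('X - r%:P) %| rQ.2.
  move=> N; have [[//|r s] [szs] /dvdpP[W PE]] := PNs N.
  exists (r, W * \prod_(j <- s) ('X - j%:P)) => /=; split.
    by rewrite PE big_cons mulrCA.
  by exists s => //; exact: dvdp_mull.
pose r N := (rQ N).1; pose Q N := (rQ N).2.
have PQ N : PN N = ('X - (r N)%:P) * Q N by case: (rQP N).
have QS N : exists2 s : seq R, size s = p & \prod_(r <- s) ('X - r%:P) %| Q N.
  by case: (rQP N).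
have szQ N : (size (Q N) <= n)%N.
  have [->|Q0] := eqVneq (Q N) 0; first by rewrite size_poly0.
  by have := szPN N; rewrite PQ mulrC size_Mmonic ?monicXsubC// size_XsubC addn2.
have coefQ N i : (Q N)`_i = (PN N)`_i.+1 + r N * (Q N)`_i.+1.
  by rewrite PQ mulrBl coefB coefXM coefCM /= subrK.
have coefP N i : (PN N)`_i = (if i is j.+1 then (Q N)`_j else 0) - r N * (Q N)`_i.
  by rewrite PQ mulrBl coefB coefXM coefCM; case: i.
pose S := \sum_(i < n.+1) `|P`_i|.
have cvS : (\sum_(i < n.+1) `|(PN N)`_i|) @[N --> U] --> S.
  by apply: cvg_big => [|i _]; [exact: add_continuous|apply: cvg_norm; exact: cvP].
have [l rl] : exists l : R, r N @[N --> U] --> l.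
  apply: (@ultra_bounded_cvg R U r (1 + (`|P`_n| / 2)^-1 * (S + 1))).
  have nPn : 0 < `|P`_n| by rewrite normr_gt0.
  have near1 : \forall N \near U, `|P`_n| / 2 < `|(PN N)`_n|.
    by apply: (cvgr_gt `|P`_n|); [exact: cvg_norm|lra].
  have near2 : \forall N \near U, \sum_(i < n.+1) `|(PN N)`_i| < S + 1.
    by apply: (cvgr_lt S) => //; lra.
  near=> N.
  have N1 : `|P`_n| / 2 < `|(PN N)`_n| by near: N.
  have N2 : \sum_(i < n.+1) `|(PN N)`_i| < S + 1 by near: N.
  have PNn : (PN N)`_n != 0 by rewrite -normr_gt0; lra.
  have szE : size (PN N) = n.+1.
    apply/eqP; rewrite eqn_leq szPN ltnNge.
    by apply: contra PNn => h; rewrite nth_default.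
  have PN0 : PN N != 0 by rewrite -size_poly_eq0 szE.
  have : (PN N).[r N] = 0 by rewrite PQ !hornerE subrr mul0r.
  move=> /(cauchy_boundP PN0) /ltW /le_trans; apply.
  rewrite /cauchy_bound lerD2l szE lead_coefE szE /= ler_pM ?invr_ge0//.
  - by rewrite sumr_ge0.
  - by rewrite lef_pV2 ?posrE; lra.
  - exact: ltW.
have cvQ i : exists q : R, (Q N)`_i @[N --> U] --> q.
  (* by decreasing index, from the recurrence [coefQ] of Horner's scheme *)
  have cvQn k : exists q : R, (Q N)`_(n - k) @[N --> U] --> q.
    elim: k => [|k [q cq]].
      exists 0; apply: cvg_near_cst; near=> N.
      by rewrite nth_default ?subn0.
    have [kn|nk] := ltnP k n; last by exists q; rewrite (_ : n - k.+1 = n - k)%N//; lia.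
    exists (P`_(n - k) + l * q).
    rewrite (_ : (fun N => _) = (fun N => (PN N)`_(n - k) + r N * (Q N)`_(n - k))).
      by apply: cvgD => //; exact: cvgM.
    by apply: funext => N; rewrite coefQ subnSK.
  have [ni|ni] := leqP i n; first by rewrite -(subKn ni).
  exists 0; apply: cvg_near_cst; near=> N.
  by rewrite nth_default// (leq_trans (szQ N))// ltnW.
have [q qE] := choice cvQ.
have q0 i : (n <= i)%N -> q i = 0.
  move=> ni; have : (fun N => (Q N)`_i) = cst 0.
    by apply: funext => N; rewrite nth_default// (leq_trans (szQ N)).
  by move=> Q0; have := qE i; rewrite Q0 => /(norm_cvg_unique (cvg_cst _)).
pose Ql := \poly_(i < n) q i.
have QlE i : Ql`_i = q i by rewrite coef_poly; case: ltnP => // /q0.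
have PE : P = ('X - l%:P) * Ql.
  apply/polyP => i; rewrite mulrBl coefB coefXM coefCM !QlE.
  apply: (norm_cvg_unique (cvP i)) => /=.
  rewrite (_ : (fun N => _) =
      fun N => (if i is j.+1 then (Q N)`_j else 0) - r N * (Q N)`_i); last first.
    by apply: funext => N; rewrite coefP.
  apply: cvgB; last by apply: cvgM.
  by case: i => [|i] /=; [exact: cvg_cst|exact: qE].
have [n0|n0] := posnP n.
  by case/eqP: Pn0; rewrite PE /Ql n0 poly_def big_ord0 mulr0 coef0.
have [|||s szs sQ] := IH n.-1 Q Ql _ _ _ QS.
- by move=> N; rewrite prednK.
- by move=> i; rewrite QlE.
- move: Pn0; rewrite PE mulrBl coefB coefXM coefCM gtn_eqF//= (QlE n) q0//.
  by rewrite mulr0 subr0.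
exists (l :: s); first by rewrite /= szs.
by rewrite big_cons PE dvdp_mul2l// polyXsubC_eq0.
Unshelve. all: by end_near. Qed.

(** * Laguerre's theorem on complex zero decreasing sequences *)

Definition negative_rooted (R : realType) (phi : {poly R}) : Prop :=
  exists c : R, exists s : seq R, [/\ c != 0, forall al, al \in s -> 0 < al &
    phi = c *: \prod_(al <- s) ('X + al%:P)].

(** [al + X D] multiplies ['X^k] by [al + k]. *)
Lemma coef_foldr_laguerre (R : realType) (s : seq R) (P : {poly R}) k :
  (foldr (fun al Q => al *: Q + 'X * Q^`()) P s)`_k =
  (\prod_(al <- s) ('X + al%:P)).[k%:R] * P`_k.
Proof.
elim: s => [|al s IH] /=; first by rewrite big_nil hornerC mul1r.
rewrite coefD coefZ coefXM coef_deriv big_cons hornerM hornerD hornerX hornerC.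
case: k IH => [|k] -> /=; first by rewrite addr0 add0r mulrA.
by rewrite -[X in _ + X]mulr_natl; ring.
Qed.

Lemma diag_op_horner_real_roots (R : realType) (phi P : {poly R}) (s : seq R) :
  negative_rooted phi -> \prod_(r <- s) ('X - r%:P) %| P ->
  exists2 s' : seq R, size s' = size s &
    \prod_(r <- s') ('X - r%:P) %| diag_op (fun k => phi.[k%:R]) P.
Proof.
move=> [c [t [c0 t0 ->]]] sP.
have -> : diag_op (fun k => (c *: \prod_(al <- t) ('X + al%:P)).[k%:R]) P =
    c *: foldr (fun al Q => al *: Q + 'X * Q^`()) P t.
  apply/polyP => k; rewrite coefZ coef_foldr_laguerre coef_poly hornerZ mulrA.
  by case: ltnP => // szk; rewrite nth_default ?mulr0.
suff [s' szs' s'P] : exists2 s' : seq R, size s' = size s &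
    \prod_(r <- s') ('X - r%:P) %| foldr (fun al Q => al *: Q + 'X * Q^`()) P t.
  by exists s'; rewrite ?dvdpZr.
elim: t t0 => [|al t IH] t0 /=; first by exists s.
have [|s' <- s'P] := IH; first by move=> be bt; apply: t0; rewrite inE bt orbT.
by apply: laguerre_step => //; exact/t0/mem_head.
Qed.

(** Since [gamma] does not vanish, the polynomials obtained along the sequence and in
    the limit all have the degree of [P]. *)
Theorem czds_of_lim (R : realType) (phi : nat -> {poly R}) (gamma : nat -> R) :
  (forall N, negative_rooted (phi N)) ->
  (forall k, (phi N).[k%:R] @[N --> \oo] --> gamma k) ->
  (forall k, gamma k != 0) -> complex_zero_decreasing_sequence gamma.
Proof.
move=> phiN cvphi gamma0 P; have [->|P0] := eqVneq P 0.
  by rewrite /diag_op size_poly0 poly_def big_ord0.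
have gP k : (diag_op gamma P)`_k = gamma k * P`_k.
  by rewrite coef_poly; case: ltnP => // szk; rewrite nth_default ?mulr0.
have gPn : (diag_op gamma P)`_(size P).-1 != 0.
  by rewrite gP mulf_neq0// -lead_coefE lead_coef_eq0.
have gP0 : diag_op gamma P != 0 by apply: contraNneq gPn => ->; rewrite coef0.
have [s szs sP] := (nonreal_zeros_leP _ P0).1 (leqnn _).
have [U [UU ooU]] := @ultraFilterLemma nat \oo _.
have [||||s' szs' s'P] := @ultra_lim_real_roots R U
    (fun N => diag_op (fun k => (phi N).[k%:R]) P) (diag_op gamma P)
    (size P).-1 (size s) UU.
- by move=> N; rewrite prednK ?size_poly_gt0// size_poly.
- move=> k; rewrite gP; rewrite (_ : (fun N => _) = fun N => (phi N).[k%:R] * P`_k).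
    by apply: cvgMl; apply: cvg_trans (cvphi k); exact: cvg_app.
  apply: funext => N; rewrite coef_poly.
  by case: ltnP => // szk; rewrite nth_default ?mulr0.
- by [].
- by move=> N; exact: diag_op_horner_real_roots.
apply/(nonreal_zeros_leP _ gP0); exists s' => //.
rewrite szs'; apply: leq_trans szs.
by rewrite -!subn1 leq_sub2r// size_poly.
Qed.

(** * Polynomials without zeros in the upper half-plane *)

Definition upper_stable (R : realType) (p : {poly R[i]}) : Prop :=
  forall z : R[i], 0 < complex.Im z -> ~~ root p z.

Definition sqmod (R : realType) (z : R[i]) : R :=
  complex.Re z ^+ 2 + complex.Im z ^+ 2.

(** A closed condition under pointwise limits which characterizes, among nonzero
    polynomials, those without zeros in the open upper half-plane. *)
Definition modulus_increasing (R : realType) (p : {poly R[i]}) : Prop :=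
  forall x y y' : R, 0 <= y <= y' -> sqmod p.[x +i* y] <= sqmod p.[x +i* y'].

Lemma sqmodM (R : realType) (z w : R[i]) : sqmod (z * w) = sqmod z * sqmod w.
Proof. by case: z w => [a b] [c d]; rewrite /sqmod /=; ring. Qed.

Lemma sqmod_ge0 (R : realType) (z : R[i]) : 0 <= sqmod z.
Proof. by rewrite addr_ge0 ?sqr_ge0. Qed.

Lemma sqmod_eq0 (R : realType) (z : R[i]) : (sqmod z == 0) = (z == 0).
Proof.
by case: z => a b; rewrite /sqmod eq_complex paddr_eq0 ?sqr_ge0// !sqrf_eq0.
Qed.

(** If [Im z <= 0] then [|x + i y - z|] increases with [y >= 0]; multiply over the
    zeros. *)
Lemma upper_stable_modulus (R : realType) (p : {poly R[i]}) :
  upper_stable p -> modulus_increasing p.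
Proof.
move=> pS x y y' /andP[y0 yy'].
have [zs pE] := closed_field_poly_normal p.
have p0 : p != 0.
  by apply: contraPneq (pS 'i ltr01) => ->; rewrite root0.
have zsP z : z \in zs -> complex.Im z <= 0.
  move=> zzs; rewrite leNgt; apply/negP => /pS.
  by rewrite pE rootZ ?lead_coef_eq0// root_prod_XsubC zzs.
rewrite pE !hornerZ !sqmodM ler_wpM2l ?sqmod_ge0//.
elim: zs zsP {pE} => [|z zs IH] zsP; first by rewrite big_nil !hornerC.
rewrite big_cons !hornerM !sqmodM ler_pM ?sqmod_ge0//; last first.
  by apply: IH => w wzs; apply: zsP; rewrite inE wzs orbT.
have := zsP z (mem_head _ _); case: z {zsP} => u v /= v0.
rewrite !hornerXsubC /sqmod /= lerD2l ler_sqr ?nnegrE; lra.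
Qed.

(** A zero in the upper half-plane would entail zeros on the whole vertical segment
    below it. *)
Lemma modulus_upper_stable (R : realType) (p : {poly R[i]}) :
  p != 0 -> modulus_increasing p -> upper_stable p.
Proof.
move=> p0 pM [x y] /= y0; apply/negP => pz.
pose rs := [seq x +i* (y / k.+1%:R) | k <- iota 0 (size p)].
have : (size rs < size p)%N.
  apply: max_poly_roots => //.
    apply/allP => _ /mapP[k _ ->]; rewrite /root -sqmod_eq0 eq_le sqmod_ge0 andbT.
    have -> : 0 = sqmod p.[x +i* y].
      by apply/esym/eqP; rewrite sqmod_eq0.
    apply: pM; apply/andP; split; first by rewrite divr_ge0 ?ltW.
    rewrite ler_pdivrMr ?ltr0n//.
    by apply: ler_peMr; [exact: ltW|rewrite ler1n].
  rewrite map_inj_uniq ?iota_uniq// => i j [/(mulfI _)].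
  by rewrite gt_eqF// => /(_ isT) /invr_inj /eqP; rewrite eqr_nat eqSS => /eqP.
by rewrite size_map size_iota ltnn.
Qed.

Lemma only_real_zerosP (R : realType) (P : {poly R}) : P != 0 ->
  only_real_zeros P <-> upper_stable (complexify P).
Proof.
move=> P0; split=> [[/eqP|PR z z0]|PS]; first by rewrite (negPf P0).
  apply/negP => /PR /RIm_real/complexI zI.
  by rewrite zI ltxx in z0.
have nIm z : root (complexify P) z -> complex.Im z <= 0.
  by move=> rz; rewrite leNgt; apply/negP => /PS; rewrite rz.
right=> z rz; have := nIm z rz.
have : complex.Im (z^*)%C <= 0.
  apply: nIm; rewrite -complex_root_conj /complexify -map_poly_comp.
  by rewrite (eq_map_poly (g := real_complex R))// => r /=; rewrite oppr0.
case: z {rz} => u v /=; rewrite oppr_le0 => v0 v1.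
by rewrite complex_real eq_le v0 v1.
Qed.

Lemma deriv_prod_XsubC_horner (F : fieldType) (zs : seq F) (w : F) :
  w \notin zs ->
  (\prod_(z <- zs) ('X - z%:P))^`().[w] =
  (\prod_(z <- zs) ('X - z%:P)).[w] * \sum_(z <- zs) (w - z)^-1.
Proof.
elim: zs => [|z zs IH]; first by rewrite !big_nil derivC hornerC mulr0.
rewrite inE negb_or => /andP[wz /IH {}IH].
rewrite !big_cons derivM derivXsubC mul1r hornerD !hornerM IH hornerXsubC.
by field; rewrite subr_eq0.
Qed.

(** In the upper half-plane [p' / p] lies in the lower one, being a sum of
    inverses of [z - z_j]; so it cannot equal [- al / w]. *)
Lemma upper_stable_deriv (R : realType) (p : {poly R[i]}) (al : R) (w : R[i]) :
  0 < al -> 0 <= complex.Im w -> upper_stable p ->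
  upper_stable (al%:C *: p + w *: p^`()).
Proof.
move=> al0 w0 pS z z0.
have [zs pE] := closed_field_poly_normal p.
have pz := pS z z0.
have p0 : p != 0 by apply: contraNneq pz => ->; rewrite root0.
have zsP u : u \in zs -> complex.Im u <= 0.
  move=> zzs; rewrite leNgt; apply/negP => /pS.
  by rewrite pE rootZ ?lead_coef_eq0// root_prod_XsubC zzs.
have zzs : z \notin zs by apply/negP => /zsP; rewrite leNgt z0.
pose S := \sum_(u <- zs) (z - u)^-1.
have SP : S = 0 \/ complex.Im S < 0.
  rewrite /S; elim: zs zsP {pE zzs S} => [|u zs IH] zsP; first by left; rewrite big_nil.
  right; rewrite big_cons.
  have {}IH := IH (fun v vzs => zsP v (mem_behead (s := u :: zs) vzs)).
  have uz : complex.Im ((z - u)^-1) < 0.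
    have := zsP u (mem_head _ _); case: (z) (u) z0 => [a b] [c d] /= b0 d0.
    rewrite oppr_lt0 divr_gt0//; first by lra.
    by rewrite ltr_wpDl ?sqr_ge0// exprn_gt0//; lra.
  case: IH => [->|]; first by rewrite addr0.
  by case: (_^-1) uz (\sum_(_ <- _) _) => [? ?] /= ? [? ?] /= ?; lra.
have pE' : p^`().[z] = p.[z] * S.
  by rewrite pE derivZ !hornerZ deriv_prod_XsubC_horner// mulrA.
rewrite /root hornerD !hornerZ pE' mulrCA (mulrC _ p.[z]) -mulrDr mulf_neq0//.
apply/negP => /eqP; case: SP => [->|].
  by rewrite mulr0 addr0 => /complexI al00; rewrite al00 ltxx in al0.
case: (w) w0 S {pE'} => w1 w2 /= w20 [s1 s2] /= s20 [E1 E2].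
have : w2 * (s1 ^+ 2 + s2 ^+ 2) = al * s2.
  have -> : w2 * (s1 ^+ 2 + s2 ^+ 2) =
      s1 * (w1 * s2 + w2 * s1) - s2 * (w1 * s1 - w2 * s2) by ring.
  have -> : w1 * s2 + w2 * s1 = 0 by rewrite -[RHS]E2; ring.
  have -> : w1 * s1 - w2 * s2 = - al.
    by apply/eqP; rewrite -subr_eq0 -[X in _ == X]E1; apply/eqP; ring.
  by ring.
apply/eqP; rewrite gt_eqF// (@lt_le_trans _ _ 0)//; first by rewrite pmulr_rlt0.
by rewrite mulr_ge0// addr_ge0 ?sqr_ge0.
Qed.

(** * Schur's composition and multiplier sequences *)

(** The left-hand side is [phi (w D) p], for [phi] the product on the right. *)
Lemma foldr_deriv_coef (R : realType) (s : seq R) (w : R[i]) (p : {poly R[i]}) m :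
  (size p <= m)%N ->
  foldr (fun al q => al%:C *: q + w *: q^`()) p s =
  \sum_(k < m) (((\prod_(al <- s) ('X + al%:P))`_k)%:C * w ^+ k) *: p^`(k).
Proof.
move=> szp; have pm := derivn_poly0 szp.
elim: s => [|al s IH].
  rewrite big_nil /=; case: m szp {pm} => [|m] szp.
    by rewrite big_ord0; apply/eqP; rewrite -size_poly_leq0.
  rewrite big_ord_recl coefC mulr1 scale1r big1 ?addr0// => k _.
  by rewrite coefC mul0r scale0r.
rewrite /= IH big_cons; set phi := \prod_(_ <- _) _.
rewrite (linear_sum (@deriv R[i])) /= !scaler_sumr.
have -> : \sum_(k < m) w *: (((phi`_k)%:C * w ^+ k) *: p^`(k))^`() =
    \sum_(k < m) ((if k == 0 :> nat then 0 else phi`_k.-1)%:C * w ^+ k) *: p^`(k).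
  rewrite -(big_mkord xpredT (fun k : nat => w *: (((phi`_k)%:C * w ^+ k) *: p^`(k))^`())).
  rewrite -(big_mkord xpredT (fun k : nat =>
    ((if k == 0 :> nat then 0 else phi`_k.-1)%:C * w ^+ k) *: p^`(k))).
  case: m pm {szp IH} => [|m] pm; first by rewrite !big_geq.
  rewrite big_nat_recr// [RHS]big_nat_recl//= mul0r scale0r add0r.
  rewrite derivZ -derivnS pm !scaler0 addr0.
  apply: eq_bigr => k _; rewrite derivZ -derivnS scalerA.
  by congr (_ *: _); rewrite exprS; ring.
rewrite -big_split; apply: eq_bigr => k _ /=.
rewrite scalerA -scalerDl mulrDl coefD coefXM coefCM.
by congr (_ *: _); rewrite rmorphD rmorphM /=; ring.
Qed.

(** Schur's composition as an operator: [phi (w D) P] is a product of factors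
    [al + w D], each of which preserves stability as long as [Im w >= 0].
    Hence it does not vanish at [z], and this is a statement about the
    polynomial in [w] whose coefficients are [phi_k * P^(k)(z)]. *)
Lemma upper_stable_composition (R : realType) (phi : {poly R})
    (p : {poly R[i]}) (z : R[i]) :
  negative_rooted phi -> upper_stable p -> 0 < complex.Im z ->
  upper_stable (\poly_(k < size p) ((phi`_k)%:C * p^`(k).[z])).
Proof.
move=> [c [s [c0 s0 phiE]]] pS z0 w w0.
have -> : \poly_(k < size p) ((phi`_k)%:C * p^`(k).[z]) = c%:C *:
    \poly_(k < size p) (((\prod_(al <- s) ('X + al%:P))`_k)%:C * p^`(k).[z]).
  apply/polyP => k; rewrite coefZ !coef_poly phiE; case: ifP => _; last by rewrite mulr0.
  by rewrite coefZ rmorphM /= mulrA.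
rewrite rootZ; last by apply: contra_neq c0 => /complexI.
have : upper_stable (foldr (fun al q => al%:C *: q + w *: q^`()) p s).
  elim: s s0 {phiE} => [//|al s IH] s0 /=; apply: upper_stable_deriv.
  - exact/s0/mem_head.
  - exact: ltW.
  - by apply: IH => be bs; apply: s0; rewrite inE bs orbT.
move=> /(_ z z0); rewrite (foldr_deriv_coef _ _ (leqnn _)) /root.
rewrite horner_sum horner_poly; apply: contra_neq => E; rewrite -[RHS]E.
by apply: eq_bigr => k _; rewrite hornerZ mulrAC.
Qed.

(** Convergence of both coordinates, which keeps all limits in [R]. *)
Definition cvg_complex (R : realType) (u : nat -> R[i]) (l : R[i]) : Prop :=
  (complex.Re (u N) @[N --> \oo] --> complex.Re l) /\
  (complex.Im (u N) @[N --> \oo] --> complex.Im l).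

Lemma cvg_complex_cst (R : realType) (l : R[i]) : cvg_complex (fun=> l) l.
Proof. by split; exact: cvg_cst. Qed.

Lemma cvg_complex_real (R : realType) (u : nat -> R) (l : R) :
  u N @[N --> \oo] --> l -> cvg_complex (fun N => (u N)%:C) l%:C.
Proof. by move=> ul; split => //=; exact: cvg_cst. Qed.

Lemma cvg_complexD (R : realType) (u v : nat -> R[i]) (l m : R[i]) :
  cvg_complex u l -> cvg_complex v m ->
  cvg_complex (fun N => u N + v N) (l + m).
Proof.
move=> [ur ui] [vr vi]; split.
  rewrite (_ : complex.Re (l + m) = complex.Re l + complex.Re m); last first.
    by case: l m {ur ui vr vi} => ? ? [].
  rewrite (_ : (fun N => _) = fun N => complex.Re (u N) + complex.Re (v N)); first exact: cvgD.
  by apply: funext => N; case: (u N) (v N) => ? ? [].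
rewrite (_ : complex.Im (l + m) = complex.Im l + complex.Im m); last first.
  by case: l m {ur ui vr vi} => ? ? [].
rewrite (_ : (fun N => _) = fun N => complex.Im (u N) + complex.Im (v N)); first exact: cvgD.
by apply: funext => N; case: (u N) (v N) => ? ? [].
Qed.

Lemma cvg_complexM (R : realType) (u v : nat -> R[i]) (l m : R[i]) :
  cvg_complex u l -> cvg_complex v m ->
  cvg_complex (fun N => u N * v N) (l * m).
Proof.
have ReM (z w : R[i]) : complex.Re (z * w) =
    complex.Re z * complex.Re w - complex.Im z * complex.Im w by case: z w => ? ? [].
have ImM (z w : R[i]) : complex.Im (z * w) =
    complex.Re z * complex.Im w + complex.Im z * complex.Re w by case: z w => ? ? [].
move=> [ur ui] [vr vi]; split.
  by rewrite ReM; under eq_fun do rewrite ReM; apply: cvgB; exact: cvgM.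
by rewrite ImM; under eq_fun do rewrite ImM; apply: cvgD; exact: cvgM.
Qed.

Lemma cvg_complex_sum (R : realType) n (u : nat -> nat -> R[i]) (l : nat -> R[i]) :
  (forall k, cvg_complex (u k) (l k)) ->
  cvg_complex (fun N => \sum_(k < n) u k N) (\sum_(k < n) l k).
Proof.
move=> ul; elim: n => [|n IH].
  by rewrite big_ord0; under eq_fun do rewrite big_ord0; exact: cvg_complex_cst.
by rewrite big_ord_recr; under eq_fun do rewrite big_ord_recr; exact: cvg_complexD.
Qed.

Lemma cvg_complex_horner (R : realType) (p : {poly R[i]}) (u : nat -> R[i]) (l : R[i]) :
  cvg_complex u l -> cvg_complex (fun N => p.[u N]) p.[l].
Proof.
move=> ul; elim/poly_ind: p => [|p c IH].
  by rewrite horner0; under eq_fun do rewrite horner0; exact: cvg_complex_cst.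
rewrite hornerMXaddC; under eq_fun do rewrite hornerMXaddC.
by apply: cvg_complexD; [exact: cvg_complexM|exact: cvg_complex_cst].
Qed.

Lemma modulus_increasing_lim (R : realType) (q : nat -> {poly R[i]}) (p : {poly R[i]}) :
  (forall z, cvg_complex (fun N => (q N).[z]) p.[z]) ->
  (forall N, modulus_increasing (q N)) -> modulus_increasing p.
Proof.
move=> qp qM x y y' yy'.
have sq z : sqmod (q N).[z] @[N --> \oo] --> sqmod p.[z].
  have [cr ci] := qp z.
  by apply: cvgD; rewrite !expr2; under eq_fun do rewrite expr2; exact: cvgM.
apply: (ler_cvg_to (sq (x +i* y)) (sq (x +i* y'))).
by near=> N; exact: qM.
Unshelve. all: by end_near. Qed.

(** The point [z N = i / (N + 1)] is in the upper half-plane and tends to 0, so that a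
    single limit takes care of both [phi] and [z]. *)
Theorem multiplier_of_lim (R : realType) (phi : nat -> {poly R}) (gamma : nat -> R) :
  (forall N, negative_rooted (phi N)) ->
  (forall k, (phi N)`_k @[N --> \oo] --> gamma k) ->
  multiplier_sequence (fun k => k`!%:R * gamma k).
Proof.
move=> phiN cvphi P PR; have [->|P0] := eqVneq P 0.
  by left; rewrite /diag_op size_poly0 poly_def big_ord0.
have cPS := (only_real_zerosP P0).1 PR.
have [->|D0] := eqVneq (diag_op (fun k => k`!%:R * gamma k) P) 0; first by left.
apply/only_real_zerosP => //; apply: modulus_upper_stable.
  by rewrite /complexify map_poly_eq0.
pose p := complexify P; pose z N : R[i] := (0 +i* N.+1%:R^-1)%C.
have zcv : cvg_complex z 0.
  by split => /=; [exact: cvg_cst|exact: cvg_harmonic].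
apply: (@modulus_increasing_lim R
    (fun N => \poly_(k < size p) (((phi N)`_k)%:C * p^`(k).[z N]))); last first.
  move=> N; apply/upper_stable_modulus/upper_stable_composition => //.
  by rewrite -[complex.Im _]/(N.+1%:R^-1 : R) invr_gt0 ltr0n.
move=> w.
have -> : complexify (diag_op (fun k => k`!%:R * gamma k) P) =
    \poly_(k < size p) ((gamma k)%:C * p^`(k).[0]).
  apply/polyP => k; rewrite coef_map !coef_poly size_map_poly.
  case: ltnP => // szk; rewrite horner_coef0 coef_derivn addn0 ffactnn coef_map.
  rewrite -[RHS]/((gamma k)%:C * ((P`_k)%:C *+ k`!)) -[LHS]/((k`!%:R * gamma k * P`_k)%:C).
  by rewrite -[_ *+ _ in RHS]mulr_natl !rmorphM rmorph_nat; ring.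
rewrite horner_poly; under eq_fun do rewrite horner_poly.
apply: (@cvg_complex_sum R _ (fun k N => ((phi N)`_k)%:C * p^`(k).[z N] * w ^+ k)
  (fun k => (gamma k)%:C * p^`(k).[0] * w ^+ k)) => k.
apply: cvg_complexM; last exact: cvg_complex_cst.
apply: cvg_complexM; first by apply: cvg_complex_real; exact: cvphi.
exact: cvg_complex_horner.
Qed.

(** * Sign changes and alternating sums *)

Lemma negative_rooted_of_signs (R : realType) (p : {poly R}) (n : nat) (t : nat -> R) :
  size p = n.+1 -> t 0%N = 0 -> (forall k, (k < n)%N -> t k < t k.+1) ->
  (forall k, (k <= n)%N -> 0 < (-1) ^+ k * p.[- t k]) -> negative_rooted p.
Proof.
move=> szp t0 t_lt sgn; pose ts := [seq t k | k <- iota 1 n].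
have nts i : (i <= n)%N -> nth 0 (0 :: ts) i = t i.
  case: i => [//|i] i_lt.
  by rewrite /= (nth_map 0%N) ?size_iota// nth_iota.
have szts : size ts = n by rewrite size_map size_iota.
have [||cs [szcs pcs csP]] := @gap_selection R (fun c => root p (- c)) 0 ts.
- apply/(pathP 0) => i; rewrite szts => i_lt.
  by rewrite -[nth 0 ts i]/(nth 0 (0 :: ts) i.+1) !nts ?t_lt// ltnW.
- move=> i; rewrite szts => i_lt.
  rewrite -[nth 0 ts i]/(nth 0 (0 :: ts) i.+1) !nts//; last exact: ltnW.
  pose q := (- (-1) ^+ i) *: (p \Po (- 'X)).
  have qE c : q.[c] = - ((-1) ^+ i * p.[- c]).
    by rewrite hornerZ horner_comp !hornerE mulNr.
  have qi : q.[t i] < 0 by rewrite qE oppr_lt0 sgn// ltnW.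
  have qS : 0 < q.[t i.+1].
    by rewrite qE -mulNr -mulN1r -exprS sgn.
  have [||c /andP[ic ci] qc] := @poly_ivt R q (t i) (t i.+1).
  + exact/ltW/t_lt.
  + by rewrite !ltW.
  exists c.
    rewrite !lt_neqAle ic ci !andbT; apply/andP; split.
      by apply: contraTneq qc => <-; rewrite /root lt_eqF.
    by apply: contraTneq qc => ->; rewrite /root gt_eqF.
  move: qc; rewrite /root qE oppr_eq0 mulf_eq0 expf_eq0 oppr_eq0 oner_eq0 andbF.
  by [].
exists (lead_coef p), cs; split.
- by rewrite lead_coef_eq0 -size_poly_eq0 szp.
- by move=> c; exact: (allP (order_path_min lt_trans pcs)).
rewrite {1}(@all_roots_prod_XsubC _ p (map -%R cs)) ?size_map ?szcs ?szts//.
- by rewrite big_map; under eq_bigr do rewrite polyCN opprK.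
- by apply/allP => _ /mapP[c /csP[] + _ ->].
rewrite uniq_rootsE map_inj_uniq; last exact: oppr_inj.
exact: (sorted_uniq lt_trans ltxx (path_sorted pcs)).
Qed.

Lemma alternating_sum_bounds (R : realType) (t : nat -> R) (n : nat) :
  (forall i, 0 <= t i) -> (forall i, t i.+1 <= t i) ->
  0 <= \sum_(i < n) (-1) ^+ i * t i <= t 0%N.
Proof.
elim: n t => [|n IH] t t0 t_le; first by rewrite big_ord0 lexx t0.
rewrite big_ord_recl expr0 mul1r.
under eq_bigr do rewrite exprS mulN1r mulNr.
rewrite sumrN.
have := IH (fun i => t i.+1) (fun i => t0 i.+1) (fun i => t_le i.+1).
by move=> /= /andP[? ?]; have := t_le 0%N; lra.
Qed.

(** At a negative point where the largest term has index [k + 2], the terms alternate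
    and decrease on both sides of it, so that all those beyond distance 2 are
    together bounded by the first of them.  On the left this one has index [k - 1];
    [L] stands for a bound of it, since it is missing when [k = 0]. *)
Lemma alternating_center (R : realType) (p : {poly R}) (t L : R) (k : nat) :
  let T i := p`_i * t ^+ i in
  (forall i, 0 <= T i) ->
  (forall i, (i < k.+2)%N -> T i <= T i.+1) ->
  (forall i, (k.+2 <= i)%N -> T i.+1 <= T i) ->
  0 <= L -> (forall j, k = j.+1 -> T j <= L) ->
  T k.+2 - T k.+1 - T k.+3 + (T k - L) + (T k.+4 - T k.+4.+1) <=
    (-1) ^+ k.+2 * p.[- t].
Proof.
move=> T T0 Tup Tdn L0 TL.
pose m := (size p + k.+4.+1)%N.
have -> : p.[- t] = \sum_(i < m) (-1) ^+ i * T i.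
  rewrite (@horner_coef_wide _ m) ?leq_addr//.
  by apply: eq_bigr => i _; rewrite (exprNn t) /T mulrCA.
have -> : m = (k.+4.+1 + size p)%N by rewrite addnC.
rewrite big_split_ord /= (@big_ord_recr _ _ _ k.+4) (@big_ord_recr _ _ _ k.+3) /=.
rewrite (@big_ord_recr _ _ _ k.+2) (@big_ord_recr _ _ _ k.+1) (@big_ord_recr _ _ _ k) /=.
have sgn i : (-1 : R) ^+ i * (-1) ^+ i = 1 by rewrite -exprMn mulrNN mulr1 expr1n.
have left_le : (-1) ^+ k.+1 * \sum_(i < k) (-1) ^+ i * T i <= L.
  case: k sgn Tup TL {T0 Tdn m} (T0) => [|j] sgn Tup TL T0; first by rewrite big_ord0 mulr0.
  apply: le_trans (TL j erefl).
  have -> : (-1) ^+ j.+2 * \sum_(i < j.+1) (-1) ^+ i * T i =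
      \sum_(i < j.+1) (-1) ^+ i * T (j - i)%N.
    rewrite (reindex_inj rev_ord_inj) mulr_sumr; apply: eq_bigr => i _ /=.
    rewrite subSS mulrA -exprD.
    have -> : (j.+2 + (j - i) = i + (j - i).+1.*2)%N by have := ltn_ord i; lia.
    by rewrite exprD -mul2n exprM sqrrN !expr1n mulr1.
  have [//|i|_] := andP (@alternating_sum_bounds R (fun i => T (j - i)%N) j.+1 _ _);
    last by rewrite subn0.
  have [ij|ji] := ltnP i j.
    by rewrite -(subnSK ij); apply: Tup; lia.
  by rewrite (_ : j - i.+1 = j - i)%N//; lia.
have right_le : \sum_(i < size p) (-1) ^+ i * T (k.+4.+1 + i)%N <= T k.+4.+1.
  have [//|i|_] := andP (@alternating_sum_bounds R (fun i => T (k.+4.+1 + i)%N) (size p) _ _);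
    last by rewrite addn0.
  by rewrite addnS; apply: Tdn; lia.
under [\sum_(i < size p) (-1) ^+ (k.+4.+1 + i) * _]eq_bigr do rewrite exprD -mulrA.
rewrite -mulr_sumr !exprS.
move: left_le right_le (sgn k); rewrite exprS.
move: ((-1) ^+ k) (\sum_(i < k) _) (\sum_(i < size p) _) => E A B left_le right_le EE.
apply: (@le_trans _ _ (E * A + E * E * (T k.+2 - T k.+1 - T k.+3 + T k + T k.+4 - B))).
  by rewrite EE; lra.
by rewrite le_eqVlt; apply/orP; left; apply/eqP; ring.
Qed.

(** * Consequences of a nonpositive value *)

(** For [a = b] and [y = a * w] the cubic is [(1 - w) * (1 + (1 - a) * w + w^2)], which is
    nonnegative on [0, 1] when [a <= 3]; a larger [b] only increases it. *)
Lemma cubic_neg_gt3 (R : realType) (a b y : R) : 1 < a -> a < b -> 0 < y <= a ->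
  1 - y + y ^+ 2 / a - y ^+ 3 / (a ^+ 2 * b) < 0 -> 3 < a.
Proof.
move=> a1 ab /andP[y0 ya] neg.
pose w := y / a; have a0 : 0 < a by lra.
have b0 : 0 < b by lra.
have w0 : 0 < w by rewrite divr_gt0.
have w1 : w <= 1 by rewrite ler_pdivrMr ?mul1r.
have yE : y = a * w by rewrite mulrC divfK ?gt_eqF.
have E : 1 - y + y ^+ 2 / a - y ^+ 3 / (a ^+ 2 * b) =
    (1 - w) * (1 + (1 - a) * w + w ^+ 2) + w ^+ 3 * (1 - a / b).
  by rewrite yE; field; rewrite !gt_eqF.
have ab1 : 0 <= w ^+ 3 * (1 - a / b).
  by apply: mulr_ge0; rewrite ?exprn_ge0 ?(ltW w0)// subr_ge0 ler_pdivrMr// mul1r ltW.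
rewrite ltNge; apply/negP => a3; move: neg; rewrite E ltNge => /negP; apply.
by apply: addr_ge0 => //; apply: mulr_ge0; nra.
Qed.

(** Put [y = s * sqrt a], where [s < 2] if [a < 4].  As [b * sqrt a >= 5], the claim
    follows from [5 * (s - 1)^2 - s^3 + 3 * s / 2 = (2 - s) * (s^2 - 3 * s + 5 / 2) > 0]. *)
Lemma cubic_neg_bound (R : realType) (a b y : R) : 3 < a -> a < b -> 0 < y <= a ->
  1 - y + y ^+ 2 / a - y ^+ 3 / (a ^+ 2 * b) < 0 ->
  0 < 1 - 2 / Num.sqrt a + 3 / (2 * (a * b)).
Proof.
move=> a3 ab /andP[y0 ya]; have a0 : 0 < a by lra.
have := sqr_sqrtr (ltW a0); have : 0 < Num.sqrt a by rewrite sqrtr_gt0.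
move: (Num.sqrt a) => g g0 gE.
have b0 : 0 < b by lra.
have [g2|g2] := leP 2 g.
  move=> _; apply: ltr_wpDl; last by rewrite divr_gt0// mulr_gt0// mulr_gt0.
  by rewrite subr_ge0 ler_pdivrMr// mul1r.
pose s := y / g; have s0 : 0 < s by rewrite divr_gt0.
have yE : y = g * s by rewrite mulrC divfK ?gt_eqF.
have s2 : s < 2 by rewrite ltr_pdivrMr//; nra.
have -> : 1 - y + y ^+ 2 / a - y ^+ 3 / (a ^+ 2 * b) =
    ((g * b) * (1 + s ^+ 2) - a * b * s - s ^+ 3) / (g * b).
  by rewrite yE -gE; field; rewrite !gt_eqF.
rewrite pmulr_llt0 ?invr_gt0 ?mulr_gt0// => neg.
have -> : 1 - 2 / g + 3 / (2 * (a * b)) = (a * b - 2 * (g * b) + 3 / 2) / (a * b).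
  by rewrite -gE; field; rewrite !gt_eqF.
rewrite divr_gt0 ?mulr_gt0//.
have gb : 5 <= g * b by nra.
have pos : 0 < (2 - s) * (s ^+ 2 - 3 * s + 5 / 2).
  by apply: mulr_gt0; [lra|have := sqr_ge0 (s - 3 / 2); nra].
have : 0 < s * (a * b - 2 * (g * b) + 3 / 2).
  have : 0 <= (g * b - 5) * (s - 1) ^+ 2 by rewrite mulr_ge0 ?subr_ge0// sqr_ge0.
  by nra.
by rewrite pmulr_rgt0.
Qed.

(** * Damped partial sums and their signs *)

Definition term_ratio (R : realType) (a_ : nat -> R) (k : nat) : R := a_ k / a_ k.+1.

Definition alternate (R : realType) (a b : R) (k : nat) : R := if odd k then b else a.

Definition alternating_ratios (R : realType) (a b : R) (a_ : nat -> R) : Prop :=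
  (forall k, 0 < a_ k) /\
  (forall k, term_ratio a_ k.+1 = term_ratio a_ k * alternate a b k).

(** With the factor 2/3 the last quotient of the coefficients is at least
    [3 a / 2 > 4] if [a > 3], which separates the last two zeros; and because of
    [2/3 < 1 - 1 / b], at a point of [[- a_1 / a_2, 0]] the last term stays below the
    tail of the series that it replaces. *)
Definition damped_sum (R : realType) (a_ : nat -> R) (n : nat) : {poly R} :=
  \poly_(k < n.+1) (if k == n then 2 / 3 * a_ n else a_ k).

Lemma term_ratio_gt0 (R : realType) (a b : R) (a_ : nat -> R) k :
  alternating_ratios a b a_ -> 0 < term_ratio a_ k.
Proof. by move=> [a0 _]; rewrite divr_gt0. Qed.

Lemma alternateSS (R : realType) (a b : R) k : alternate a b k.+2 = alternate a b k.
Proof. by rewrite /alternate /= negbK. Qed.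

Lemma alternateM (R : realType) (a b : R) k :
  alternate a b k * alternate a b k.+1 = a * b.
Proof. by rewrite /alternate /=; case: odd => //=; rewrite mulrC. Qed.

Lemma alternate_ge (R : realType) (a b : R) k : a < b -> a <= alternate a b k.
Proof. by rewrite /alternate; case: odd => // /ltW. Qed.

Lemma term_ratio_le (R : realType) (a b : R) (a_ : nat -> R) i j :
  1 < a -> a < b -> alternating_ratios a b a_ ->
  (i <= j)%N -> term_ratio a_ i <= term_ratio a_ j.
Proof.
move=> a1 ab ar; elim: j => [|j IH]; first by rewrite leqn0 => /eqP ->.
rewrite leq_eqVlt => /predU1P[->//|/IH /le_trans]; apply.
rewrite ar.2 ler_peMr ?ltW ?(term_ratio_gt0 _ ar)//.
by apply: lt_le_trans a1 _; exact: alternate_ge.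
Qed.

Lemma damped_sum_term (R : realType) (a_ : nat -> R) (n i : nat) (t : R) :
  (forall k, 0 < a_ k) ->
  (damped_sum a_ n)`_i.+1 * t ^+ i.+1 =
  (damped_sum a_ n)`_i * t ^+ i *
    ((if (i.+1 < n)%N then 1 else if i.+1 == n then 2 / 3 else 0) *
     (t / term_ratio a_ i)).
Proof.
move=> a0; have a0' k : a_ k != 0 by rewrite gt_eqF.
rewrite !coef_poly /term_ratio exprS; have [ltin|ltni|eqin] := ltngtP i.+1 n.
- rewrite !ltnS ltnW// (ltnW (ltnW ltin)) (ltn_eqF (ltnW ltin)).
  by field; rewrite !a0'.
- by rewrite ltnS leqNgt ltni !mul0r mulr0.
- rewrite -eqin !ltnS leqnn leqnSn ltn_eqF//.
  by field; rewrite !a0'.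
Qed.

(** The sign is that of the term of index [k + 2] at the geometric mean [r_(k+1) * sqrt C] of
    [r_(k+1)] and [r_(k+2)]: on each side the second term exceeds the third by at least
    8/9 of [1 / (a b)] times the central one, or by 2/3 of it if the second one on the
    right is the damped last term; and 8/9 + 2/3 is greater than 3/2.  For the last
    two indices, where terms are missing on the right, the leading coefficient is
    small enough to leave room for a cruder choice of the point. *)
Lemma damped_sum_sign (R : realType) (a b : R) (a_ : nat -> R) (n k : nat) :
  3 < a -> a < b -> 0 < 1 - 2 / Num.sqrt a + 3 / (2 * (a * b)) ->
  alternating_ratios a b a_ -> (k.+2 <= n)%N ->
  exists2 t : R, term_ratio a_ k.+1 < t <= term_ratio a_ k.+2 &
    0 < (-1) ^+ k.+2 * (damped_sum a_ n).[- t].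
Proof.
move=> a3 ab key ar kn; have a0 : 0 < a by lra.
have a1 : 1 < a by lra.
have b0 : 0 < b by lra.
have ab9 : 9 < a * b by nra.
pose r := term_ratio a_; have r0 j : 0 < r j := term_ratio_gt0 j ar.
have rS j : r j.+1 = r j * alternate a b j := ar.2 j.
have r_le i j : (i <= j)%N -> r i <= r j := term_ratio_le a1 ab ar.
pose C := alternate a b k.+1; pose D := alternate a b k.
have aC : a <= C by exact: alternate_ge.
have aD : a <= D by exact: alternate_ge.
have DC : D * C = a * b by exact: alternateM.
have C0 : 0 < C by lra.
have D0 : 0 < D by lra.
set p := damped_sum a_ n.
pose th i : R := if (i.+1 < n)%N then 1 else if i.+1 == n then 2 / 3 else 0.
have th0 i : 0 <= th i by rewrite /th; case: ifP => // _; case: ifP => // _; lra.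
have th1 i : th i <= 1 by rewrite /th; case: ifP => // _; case: ifP => // _; lra.
have th_lt j : (j.+1 < n)%N -> th j = 1 by rewrite /th => ->.
have th_last j : j.+1 = n -> th j = 2 / 3 by rewrite /th => ->; rewrite ltnn eqxx.
have th_ge j : (n <= j)%N -> th j = 0.
  by rewrite /th => nj; rewrite ltnNge leqW//= gtn_eqF// ltnS.
have kn1 : (k < n)%N by exact: ltnW.
have p0 i : 0 <= p`_i.
  rewrite coef_poly; case: ifP => // _; case: ifP => _; last by rewrite ltW// ar.1.
  by rewrite mulr_ge0 ?ltW ?ar.1//; lra.
have pk : 0 < p`_k.
  by rewrite coef_poly ltnS (ltnW (ltnW kn)) ltn_eqF ?ar.1//; exact: ltnW.
(* the inequality at [k + 1] is singled out because there the damping may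
   occur on the increasing side *)
suff [t [t_gt t_le up [L [L0 TL]]]] : exists t : R, [/\ r k.+1 < t, t <= r k.+2,
    1 <= th k.+1 * (t / r k.+1) &
    let T i := p`_i * t ^+ i in
    exists L, [/\ 0 <= L, forall j, k = j.+1 -> T j <= L &
      0 < T k.+2 - T k.+1 - T k.+3 + (T k - L) + (T k.+4 - T k.+4.+1)]].
  move=> pos; exists t; rewrite ?t_gt//.
  have t0 : 0 < t by exact: lt_trans t_gt.
  have TS i := damped_sum_term n i t ar.1.
  have T0 i : 0 <= p`_i * t ^+ i by rewrite mulr_ge0// exprn_ge0// ltW.
  apply: lt_le_trans pos _; apply: alternating_center => // i.
    rewrite ltnS leq_eqVlt => /predU1P[->|ik].
      by rewrite (TS k.+1) ler_peMr.
    rewrite (TS i) ler_peMr// [X in X * _]ifT; last by rewrite (leq_trans _ kn).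
    rewrite mul1r ler_pdivlMr// mul1r ltW// (le_lt_trans _ t_gt)// r_le//.
    exact: ltnW.
  move=> ik; rewrite (TS i); apply: ler_piMr => //.
  apply: mulr_ile1; [exact: th0| |exact: th1|].
  - by rewrite divr_ge0// ltW.
  - by rewrite ler_pdivrMr// mul1r (le_trans t_le)// r_le.
have rk1 : r k.+1 = r k * D by exact: rS.
have rk2 : r k.+2 = r k.+1 * C by exact: rS.
have rk3 : r k.+3 = r k.+2 * D by rewrite rS alternateSS.
have rk4 : r k.+4 = r k.+3 * C by rewrite rS alternateSS.
have rne j : r j != 0 by rewrite gt_eqF.
have rE : r k.+2 / r k.+1 = C by rewrite rk2 mulrAC divff// mul1r.
have Cn : C != 0 by rewrite gt_eqF.
have Dn : D != 0 by rewrite gt_eqF.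
have pk1 : 0 < p`_k.+1.
  by rewrite coef_poly ltnS kn1 ltn_eqF ?ar.1.
have pT0 (t : R) i : 0 < t -> 0 <= p`_i * t ^+ i.
  by move=> t0; rewrite mulr_ge0 ?exprn_ge0// ltW.
have pTS (t : R) i : p`_i.+1 * t ^+ i.+1 = p`_i * t ^+ i * (th i * (t / r i)).
  by exact: damped_sum_term ar.1.
have pTle (t : R) j : r k.+1 <= t -> k = j.+1 -> p`_j * t ^+ j <= p`_k * t ^+ k.
  move=> tk kj; have t0 := lt_le_trans (r0 _) tk.
  rewrite kj pTS th_lt -?kj// mul1r ler_peMr ?pT0// ler_pdivlMr// mul1r.
  by apply: le_trans tk; apply: r_le; rewrite kj leqW.
move: kn; rewrite leq_eqVlt => /predU1P[nE|].
  (* the centre is the last term *)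
  have th2 j : (k.+2 <= j)%N -> th j = 0 by rewrite nE; exact: th_ge.
  exists (r k.+2); split => //.
  - by rewrite rk2 ltr_pMr//; lra.
  - by rewrite th_last// rE; lra.
  move=> T; exists (T k); split; [exact: pT0|by move=> j; apply: pTle; exact: r_le|].
  have T1 : 0 < T k.+1 by rewrite mulr_gt0 ?exprn_gt0.
  have T2 : T k.+2 = T k.+1 * (2 / 3 * C) by rewrite /T pTS th_last// rE.
  have T3 : T k.+3 = 0 by rewrite /T pTS th2// mul0r mulr0.
  have T4 : T k.+4 = 0 by rewrite /T pTS -/(T k.+3) T3 mul0r.
  have T5 : T k.+4.+1 = 0 by rewrite /T pTS -/(T k.+4) T4 mul0r.
  by rewrite T2 T3 T4 T5; nra.
rewrite leq_eqVlt => /predU1P[nE|kn].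
  (* the centre is the last but one term *)
  have th3 j : (k.+3 <= j)%N -> th j = 0 by rewrite nE; exact: th_ge.
  have r20 : 0 < 2 * r k.+1 by rewrite mulr_gt0.
  have rle2 : r k.+1 <= 2 * r k.+1 by rewrite ler_peMl ?ltW//; lra.
  exists (2 * r k.+1); split => //.
  - by rewrite ltr_pMl//; lra.
  - by rewrite rk2 mulrC ler_wpM2l ?ltW//; lra.
  - by rewrite th_lt -?nE// mul1r mulfK//; lra.
  move=> T; exists (T k); split; [exact: pT0|by move=> j; exact: pTle|].
  have T1 : 0 < T k.+1 by rewrite mulr_gt0 ?exprn_gt0.
  have T2 : T k.+2 = T k.+1 * 2 by rewrite /T pTS th_lt -?nE// mul1r mulfK.
  have T3 : T k.+3 = T k.+1 * 2 * (2 / 3 * (2 / C)).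
    rewrite -T2 /T pTS th_last//; congr (_ * (_ * _)).
    by rewrite rk2 (mulrC 2) -mulf_div divff// mul1r.
  have T4 : T k.+4 = 0 by rewrite /T pTS th3// mul0r mulr0.
  have T5 : T k.+4.+1 = 0 by rewrite /T pTS -/(T k.+4) T4 mul0r.
  rewrite T2 T3 T4 T5 subrr !addr0 subrr addr0.
  have : 2 / C < 2 / 3 by rewrite ltr_pM2l// ltf_pV2 ?posrE; lra.
  have : 0 < 2 / C by rewrite divr_gt0.
  by move: (2 / C) => c c0 c1; nra.
(* two terms on each side of the centre *)
have sC0 : 0 < Num.sqrt C by rewrite sqrtr_gt0.
have sCE := sqr_sqrtr (ltW C0).
have keyC : 0 < 1 - 2 / Num.sqrt C + 3 / (2 * (a * b)).
  apply: (lt_le_trans key); rewrite lerD2r lerD2l lerN2 ler_wpM2l//.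
  by rewrite lef_pV2 ?posrE ?sqrtr_gt0// ler_wsqrtr.
move: (Num.sqrt C) sC0 sCE keyC => g g0 gE keyC.
have gn : g != 0 by rewrite gt_eqF.
have g1 : 1 < g by nra.
exists (r k.+1 * g); split => //.
- by rewrite ltr_pMr.
- by rewrite rk2 ler_wpM2l ?ltW//; nra.
- by rewrite th_lt ?(ltnW kn)// mul1r mulrAC divff// mul1r ltW.
have t0 : 0 < r k.+1 * g by rewrite mulr_gt0.
move=> T; have T0 i : 0 <= T i by exact: pT0.
have TS i : T i.+1 = T i * (th i * (r k.+1 * g / r i)) by exact: pTS.
have Tk : 0 < T k by rewrite mulr_gt0 ?exprn_gt0.
have Tk1 : T k.+1 = T k * (g * D).
  by rewrite TS th_lt ?(ltnW (ltnW kn))// rk1; field.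
have Tk2 : T k.+2 = T k * (a * b).
  by rewrite TS Tk1 th_lt ?(ltnW kn)// -DC -gE; field.
have Tk3 : T k.+3 = T k * (g * D).
  by rewrite TS Tk2 th_lt// rk2 -DC -gE; field; rewrite ?rne ?Cn ?Dn ?gn.
have Tk4 : T k.+4 = T k * th k.+3.
  by rewrite TS Tk3 rk3 rk2 -gE; field; rewrite ?rne ?Cn ?Dn ?gn.
have Tk5 : T k.+4.+1 = T k * th k.+3 * (th k.+4 / (g * (a * b))).
  by rewrite TS Tk4 rk4 rk3 rk2 -DC -gE; field; rewrite ?rne ?Cn ?Dn ?gn.
have gab : 9 <= g * (a * b) by nra.
exists (T k / 9); split; first by rewrite divr_ge0.
  move=> j kj; have rj : r k = r j * C by rewrite kj rS /C kj alternateSS.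
  have -> : T k = T j * (g * (a * b)).
    by rewrite {1}kj TS th_lt -?kj// rk1 rj -DC; field.
  by rewrite ler_pdivlMr// ler_wpM2l.
have right_ge : 2 / 3 <= th k.+3 - th k.+3 * (th k.+4 / (g * (a * b))).
  have [h0 h1] : 0 <= (g * (a * b))^-1 /\ (g * (a * b))^-1 <= 1 / 9.
    rewrite invr_ge0 mul1r lef_pV2 ?posrE ?mulr_gt0//; split => //.
    by apply: le_trans gab.
  move: kn; rewrite leq_eqVlt => /predU1P[nE|nk].
    by rewrite th_last// th_ge ?nE// mul0r mulr0; lra.
  rewrite th_lt// !mul1r; have := th0 k.+4; have := th1 k.+4.
  by move: (th k.+4) (_^-1) h0 h1 => u v ? ? ? ?; nra.
have -> : T k.+2 - T k.+1 - T k.+3 + (T k - T k / 9) + (T k.+4 - T k.+4.+1) =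
    T k * ((a * b) * (1 - 2 / g + 3 / (2 * (a * b))) +
    (th k.+3 - th k.+3 * (th k.+4 / (g * (a * b))) - 2 / 3) + 1 / 18).
  rewrite Tk1 Tk2 Tk3 Tk4 Tk5 -DC -gE; field.
  by rewrite gn Dn.
apply: mulr_gt0 => //.
have : 0 < a * b * (1 - 2 / g + 3 / (2 * (a * b))) by rewrite mulr_gt0// mulr_gt0.
by lra.
Qed.

(** * Alternating series *)

(** At a real point the partial sums are real, so the imaginary part of [f x] is
    smaller than any positive number. *)
Lemma entire_real (R : realType) (a_ : nat -> R) (f : R[i]^o -> R[i]^o) (x : R) :
  entire_with_coeffs a_ f ->
  \sum_(k < n) a_ k * x ^+ k @[n --> \oo] --> complex.Re (f x%:C) /\
  complex.Im (f x%:C) = 0.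
Proof.
move=> /(_ x%:C); set l := f x%:C => fx.
have sE n : series (fun k => (a_ k)%:C * x%:C ^+ k : R[i]^o) n =
    (\sum_(k < n) a_ k * x ^+ k)%:C.
  rewrite /series /= big_mkord rmorph_sum; apply: eq_bigr => k _.
  by rewrite rmorphM rmorphXn.
have near_lt e : 0 < e ->
    \forall n \near \oo, `|l - (\sum_(k < n) a_ k * x ^+ k)%:C| < e%:C.
  move=> e0; have /cvgrPdist_lt/(_ e%:C) := fx; rewrite ltcR => /(_ e0).
  by apply: filterS => n; rewrite sE.
have sq_lt n e : 0 < e -> `|l - (\sum_(k < n) a_ k * x ^+ k)%:C| < e%:C ->
    sqmod (l - (\sum_(k < n) a_ k * x ^+ k)%:C) < e ^+ 2.
  move=> e0 h; rewrite -ltcR /sqmod add_Re2_Im2 rmorphXn /=.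
  by rewrite ltr_pXn2r// ?nnegrE// ler0c ltW.
case: l fx near_lt sq_lt {sE} => u v fx near_lt sq_lt /=.
have sqE n : sqmod ((u +i* v)%C - (\sum_(k < n) a_ k * x ^+ k)%:C) =
    (u - \sum_(k < n) a_ k * x ^+ k) ^+ 2 + v ^+ 2.
  by rewrite /sqmod /= oppr0 addr0.
split.
  apply/cvgrPdist_lt => e e0; have := near_lt e e0; apply: filterS => n /(sq_lt n e e0).
  rewrite sqE -[in _ ^+ 2 + _](@real_normK _ (u - _)) ?num_real// => lt_e.
  rewrite -(@ltr_pXn2r _ 2) ?nnegrE ?(ltW e0)//.
  by apply: le_lt_trans lt_e; rewrite lerDl sqr_ge0.
apply/eqP; rewrite -sqrf_eq0 eq_le sqr_ge0 andbT leNgt; apply/negP => v0.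
have sv0 : 0 < Num.sqrt (v ^+ 2) by rewrite sqrtr_gt0.
have [N _ /(_ N (leqnn N))] := near_lt _ sv0.
move=> /(sq_lt _ _ sv0); rewrite sqE sqr_sqrtr ?ltW// ltNge => /negP; apply.
by rewrite lerDr sqr_ge0.
Qed.

Lemma alternating_series_bounds (R : realType) (t : nat -> R) (l : R) (m : nat) :
  ~~ odd m -> (forall i, 0 <= t i) -> (forall i, (m <= i)%N -> t i.+1 <= t i) ->
  \sum_(k < n) (-1) ^+ k * t k @[n --> \oo] --> l ->
  \sum_(k < m) (-1) ^+ k * t k + t m - t m.+1 <= l <=
    \sum_(k < m) (-1) ^+ k * t k + t m.
Proof.
move=> om t0 t_le tl; set s := \sum_(k < m) _.
have tl' : \sum_(k < n + (m + 2)) (-1) ^+ k * t k @[n --> \oo] --> l.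
  by rewrite (cvg_shiftn (m + 2) (fun n => \sum_(k < n) (-1) ^+ k * t k)).
have sE n : \sum_(k < n + (m + 2)) (-1) ^+ k * t k =
    s + t m - t m.+1 + \sum_(i < n) (-1) ^+ i * t (m.+2 + i)%N.
  rewrite (_ : (n + (m + 2) = m.+2 + n)%N); last by rewrite addn2 addnC.
  rewrite big_split_ord /= !big_ord_recr /= exprS -signr_odd (negPf om) expr0.
  rewrite mulr1 mulN1r mul1r; congr (_ + _).
  apply: eq_bigr => i _; congr (_ * _).
  rewrite -[in RHS]signr_odd -signr_odd.
  by rewrite !addSn /= negbK oddD (negPf om).
have bnd n := @alternating_sum_bounds R (fun i => t (m.+2 + i)%N) n (fun=> t0 _) _.
have {}bnd n : 0 <= \sum_(i < n) (-1) ^+ i * t (m.+2 + i)%N <= t m.+2.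
  rewrite -[in t m.+2](addn0 m.+2); apply: bnd => i.
  by rewrite addnS t_le// (leq_trans _ (leq_addr _ _))// leqW.
apply/andP; split.
  apply: (ler_cvg_to (cvg_cst _) tl'); near=> n.
  by rewrite sE lerDl; case/andP: (bnd n).
apply: (ler_cvg_to tl' (cvg_cst _)); near=> n.
rewrite sE; have /andP[_ h] := bnd n; have h' := t_le m.+1 (leqnSn m).
by lra.
Unshelve. all: by end_near. Qed.

Lemma term_ratioP (R : realType) (a b : R) (a_ : nat -> R) :
  (forall k, 0 < a_ k) ->
  (forall m, second_quotient a_ (m.*2 + 2)%N = a) ->
  (forall m, second_quotient a_ (m.*2 + 3)%N = b) -> alternating_ratios a b a_.
Proof.
move=> a0 qa qb; split=> // k.
have -> : alternate a b k = second_quotient a_ k.+2.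
  rewrite /alternate -{2}(odd_double_half k).
  by case: (odd k); rewrite ?add1n ?add0n -(qa k./2, qb k./2) ?addn2 ?addn3.
by rewrite /term_ratio /second_quotient /=; field; rewrite !gt_eqF.
Qed.

(** * The first terms *)

Lemma entire_neg_series (R : realType) (a_ : nat -> R) (f : R[i]^o -> R[i]^o) (x : R) :
  entire_with_coeffs a_ f ->
  \sum_(k < n) (-1) ^+ k * (a_ k * x ^+ k) @[n --> \oo] --> complex.Re (f (- x)%:C).
Proof.
move=> fE; have [+ _] := entire_real (- x) fE.
under eq_fun do under eq_bigr do rewrite (exprNn x) mulrCA.
by [].
Qed.

Lemma leading_terms (R : realType) (a b : R) (a_ : nat -> R) (X : R) :
  0 < a -> 0 < b -> alternating_ratios a b a_ ->
  let x := term_ratio a_ 0 * X in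
  [/\ a_ 1%N * x = a_ 0%N * X, a_ 2%N * x ^+ 2 = a_ 0%N * (X ^+ 2 / a),
      a_ 3%N * x ^+ 3 = a_ 0%N * (X ^+ 3 / (a ^+ 2 * b)) &
      a_ 4%N * x ^+ 4 = a_ 0%N * (X ^+ 4 / (a ^+ 4 * b ^+ 2))].
Proof.
move=> pa pb [a0 rS] x.
have n0 k : a_ k != 0 by rewrite gt_eqF.
have an0 : a != 0 by rewrite gt_eqF.
have bn0 : b != 0 by rewrite gt_eqF.
pose r := term_ratio a_ 0; have rn0 : r != 0 by rewrite gt_eqF ?divr_gt0.
have aS k : a_ k.+1 = a_ k / term_ratio a_ k.
  by rewrite /term_ratio invf_div mulrC divfK.
have r1 : term_ratio a_ 1 = r * a by exact: rS.
have r2 : term_ratio a_ 2 = r * a * b by rewrite rS r1.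
have r3 : term_ratio a_ 3 = r * a * b * a by rewrite rS r2.
have a1 : a_ 1%N = a_ 0%N / r by exact: aS.
have a2 : a_ 2%N = a_ 0%N / r / (r * a) by rewrite aS a1 r1.
have a3 : a_ 3%N = a_ 0%N / r / (r * a) / (r * a * b) by rewrite aS a2 r2.
have a4 : a_ 4%N = a_ 0%N / r / (r * a) / (r * a * b) / (r * a * b * a) by rewrite aS a3 r3.
by rewrite a1 a2 a3 a4 /x -/r; split; field; rewrite ?rn0 ?an0 ?bn0.
Qed.

Lemma term_decreasing (R : realType) (a b : R) (a_ : nat -> R) (x : R) i :
  1 < a -> a < b -> alternating_ratios a b a_ -> 0 <= x <= term_ratio a_ 1 ->
  (1 <= i)%N -> a_ i.+1 * x ^+ i.+1 <= a_ i * x ^+ i.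
Proof.
move=> a1 ab ar /andP[x0 x1] i1.
have xr : x <= term_ratio a_ i.
  by apply: le_trans x1 _; exact: term_ratio_le a1 ab ar i1.
have -> : a_ i.+1 * x ^+ i.+1 = a_ i * x ^+ i * (x / term_ratio a_ i).
  by rewrite exprS /term_ratio; field; rewrite !gt_eqF ?ar.1.
rewrite ler_piMr ?mulr_ge0 ?exprn_ge0 ?(ltW (ar.1 _))//.
by rewrite ler_pdivrMr ?mul1r// (term_ratio_gt0 _ ar).
Qed.

(** The partial sum of degree 4 at [- r * X] is, up to a positive factor, the self-reciprocal
    quartic [1 - c * y + a * b * y^2 - c * y^3 + y^4], with [c = a * sqrt b] and
    [X = c * y].  In terms of [y + y^-1] it is quadratic, with its minimum at
    [y + y^-1 = c / 2]; there it equals [y^2 * (a * b - 2 - c^2 / 4)], and this is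
    nonpositive exactly when [b <= 8 / (a * (4 - a))]. *)
Lemma quartic_nonpos (R : realType) (a b : R) :
  3 <= a -> a < 4 -> a < b -> b <= 8 / (a * (4 - a)) ->
  exists2 X : R, 0 < X <= a &
    1 - X + X ^+ 2 / a - X ^+ 3 / (a ^+ 2 * b) + X ^+ 4 / (a ^+ 4 * b ^+ 2) <= 0.
Proof.
move=> a3 a4 ab b_le.
have a0 : 0 < a by lra.
have b0 : 0 < b by lra.
have {}b_le : a * b * (4 - a) <= 8.
  move: b_le; rewrite ler_pdivlMr; last by rewrite mulr_gt0// subr_gt0.
  by rewrite mulrCA mulrA.
have := sqr_sqrtr (ltW b0); have : 0 < Num.sqrt b by rewrite sqrtr_gt0.
move: (Num.sqrt b) => g g0 gE.
have g32 : 3 / 2 < g by nra.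
pose w := a * g / 2.
have w2 : 2 < w by rewrite /w; nra.
have hE : 0 <= w ^+ 2 - 4 by nra.
have := sqr_sqrtr hE; have := sqrtr_ge0 (w ^+ 2 - 4).
move: (Num.sqrt _) => h h0 h2.
pose y := (w - h) / 2.
have yw : y ^+ 2 - w * y + 1 = 0 by rewrite /y; move: h2; lra.
have hw : h < w by nra.
have y0 : 0 < y by rewrite /y; lra.
have gy : g * y <= 1.
  rewrite leNgt; apply/negP => gy1.
  have q : (1 - g * y) * (1 - g * (w - y)) = 1 - g * w + g ^+ 2.
    have -> : 1 - g * w + g ^+ 2 =
        1 - g * w + g ^+ 2 * (1 - (y ^+ 2 - w * y + 1)) by rewrite yw; ring.
    by ring.
  have q0 : 1 - g * w + g ^+ 2 <= 0 by rewrite /w; nra.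
  have y' : 1 < g * (w - y).
    apply: lt_le_trans gy1 _; rewrite ler_pM2l// /y; lra.
  by nra.
exists (a * g * y).
  apply/andP; split; first by apply: mulr_gt0 => //; exact: mulr_gt0.
  by rewrite -mulrA ler_piMr// ltW.
have -> : 1 - a * g * y + (a * g * y) ^+ 2 / a - (a * g * y) ^+ 3 / (a ^+ 2 * b) +
    (a * g * y) ^+ 4 / (a ^+ 4 * b ^+ 2) =
    1 - a * g * y + a * b * y ^+ 2 - a * g * y ^+ 3 + y ^+ 4.
  by rewrite -gE; field; rewrite !gt_eqF.
have -> : 1 - a * g * y + a * b * y ^+ 2 - a * g * y ^+ 3 + y ^+ 4 =
    y ^+ 2 * (a * b - 2 - a ^+ 2 * b / 4) +
    (y ^+ 2 - w * y + 1) * (y ^+ 2 - w * y + 1).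
  by rewrite /w -gE; field.
rewrite yw mul0r addr0; apply: mulr_ge0_le0; first exact: sqr_ge0.
have -> : a * b - 2 - a ^+ 2 * b / 4 = (a * b * (4 - a) - 8) / 4 by field.
by lra.
Qed.

(** * Existence of a nonpositive value, and negative zeros *)

(** [f] lies below its partial sum of degree 4 at [- x], because the next term is
    negative and the terms decrease. *)
Lemma nonpos_of_quotients (R : realType) (a b : R) (a_ : nat -> R)
    (f : R[i]^o -> R[i]^o) :
  3 <= a -> a < 4 -> a < b -> b <= 8 / (a * (4 - a)) ->
  alternating_ratios a b a_ -> entire_with_coeffs a_ f ->
  exists z0 : R, - term_ratio a_ 1 <= z0 <= 0 /\ f z0%:C <= 0.
Proof.
move=> a3 a4 ab b_le ar fE.
have a0 : 0 < a by lra.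
have b0 : 0 < b by lra.
have a1 : 1 < a by lra.
have [X /andP[X0 Xa] Xle] := quartic_nonpos a3 a4 ab b_le.
have [] := leading_terms X a0 b0 ar; set x := _ * X => E1 E2 E3 E4.
have r0 := term_ratio_gt0 0 ar.
have x0 : 0 <= x by rewrite mulr_ge0 ?ltW.
have x1 : x <= term_ratio a_ 1 by rewrite ar.2 /alternate /= ler_wpM2l// ltW.
exists (- x); split; first by rewrite lerN2 x1 oppr_le0.
rewrite lecE (entire_real (- x) fE).2 eqxx /=.
have /andP[_] := @alternating_series_bounds R (fun k => a_ k * x ^+ k) _ 4 isT
  (fun k => mulr_ge0 (ltW (ar.1 k)) (exprn_ge0 k x0))
  (fun i i4 => term_decreasing a1 ab ar (introT andP (conj x0 x1)) (ltnW (ltnW (ltnW i4))))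
  (@entire_neg_series _ _ _ x fE).
rewrite !big_ord_recr big_ord0 /= expr1 E1 E2 E3 E4 => /le_trans; apply.
have := mulr_ge0_le0 (ltW (ar.1 0%N)) Xle.
by congr (_ <= _); ring.
Qed.

(** The signs alternate at [0], [- x] and the points of [damped_sum_sign].  At [- x] the
    damped last term [2/3 * t_n] is smaller than [t_n - t_(n+1)], which in turn is at most
    the tail of the series from index [n] on. *)
Lemma damped_sum_negative_rooted (R : realType) (a b : R) (a_ : nat -> R)
    (x l : R) (n : nat) :
  1 < a -> a < b -> alternating_ratios a b a_ -> 0 <= x <= term_ratio a_ 1 ->
  \sum_(k < n) (-1) ^+ k * (a_ k * x ^+ k) @[n --> \oo] --> l -> l <= 0 ->
  ~~ odd n -> (4 <= n)%N -> negative_rooted (damped_sum a_ n).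
Proof.
move=> a1 ab ar xr xl l0 on n4.
have /andP[x0 x1] := xr.
have a0 : 0 < a by lra.
have b0 : 0 < b by lra.
have r0 := term_ratio_gt0 0 ar.
pose t k := a_ k * x ^+ k.
have t0 k : 0 <= t k by rewrite mulr_ge0 ?exprn_ge0 ?(ltW (ar.1 _)).
have t_le i : (1 <= i)%N -> t i.+1 <= t i by exact: term_decreasing a1 ab ar xr.
have {}x0 : 0 < x.
  rewrite lt_neqAle x0 andbT; apply: contraTneq l0 => xE; rewrite -ltNge.
  have tS i : t i.+1 = 0 by rewrite /t -xE expr0n mulr0.
  have /andP[+ _] := @alternating_series_bounds R t l 0 isT t0
    (fun i _ => eq_ind_r (fun v => v <= t i) (t0 i) (tS i)) xl.
  rewrite big_ord0 tS subr0 add0r; apply: lt_le_trans.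
  by rewrite /t expr0 mulr1 ar.1.
have tpos k : 0 < t k by rewrite mulr_gt0 ?exprn_gt0 ?ar.1.
have tS k : t k.+1 = t k * (x / term_ratio a_ k).
  by rewrite /t exprS /term_ratio; field; rewrite !gt_eqF ?ar.1.
have r_gt0 k := term_ratio_gt0 k ar.
(* the first four terms have a negative sum *)
pose X := x / term_ratio a_ 0.
have Xa : 0 < X <= a.
  by rewrite divr_gt0//= ler_pdivrMr// mulrC (le_trans x1)// ar.2.
have neg : 1 - X + X ^+ 2 / a - X ^+ 3 / (a ^+ 2 * b) < 0.
  have xE : term_ratio a_ 0 * X = x by rewrite /X mulrC divfK ?gt_eqF.
  have [] := leading_terms X a0 b0 ar; rewrite xE => E1 E2 E3 _.
  have /andP[+ _] := @alternating_series_bounds R t l 4 isT t0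
    (fun i i4 => t_le i (ltnW (ltnW (ltnW i4)))) xl.
  have t54 : t 5%N < t 4%N.
    rewrite tS gtr_pMr// ltr_pdivrMr// mul1r (le_lt_trans x1)//.
    apply: (@lt_le_trans _ _ (term_ratio a_ 2)).
      by rewrite (ar.2 1%N) ltr_pMr// /alternate /=; lra.
    exact: term_ratio_le a1 ab ar _.
  rewrite !big_ord_recr big_ord0 /= /t expr1 E1 E2 E3 -/(t 4%N) -/(t 5%N) => h.
  rewrite -(pmulr_rlt0 _ (ar.1 0%N)).
  have -> : a_ 0%N * (1 - X + X ^+ 2 / a - X ^+ 3 / (a ^+ 2 * b)) =
    0 + (-1) ^+ 0 * (a_ 0%N * x ^+ 0) + (-1) ^+ 1 * (a_ 0%N * X) +
    (-1) ^+ 2 * (a_ 0%N * (X ^+ 2 / a)) +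
    (-1) ^+ 3 * (a_ 0%N * (X ^+ 3 / (a ^+ 2 * b))) by ring.
  by move: h t54 l0; lra.
have a3 := cubic_neg_gt3 a1 ab Xa neg.
have key := cubic_neg_bound a3 ab Xa neg.
have p0 : (damped_sum a_ n).[0] = a_ 0%N.
  by rewrite horner_coef0 coef_poly /= ltn_eqF// (leq_trans _ n4).
have px : (damped_sum a_ n).[- x] < 0.
  have n1 : (1 <= n)%N by exact: leq_trans n4.
  have /andP[+ _] := @alternating_series_bounds R t l n on t0
    (fun i ni => t_le i (leq_trans n1 ni)) xl.
  have tn : t n.+1 < 1 / 3 * t n.
    rewrite tS mulrC ltr_pM2r// ltr_pdivrMr// (le_lt_trans x1)//.
    apply: (@lt_le_trans _ _ (1 / 3 * term_ratio a_ 2)).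
      by rewrite (ar.2 1%N) mulrCA ltr_pMr// /alternate /=; lra.
    rewrite ler_pM2l; last by lra.
    by apply: term_ratio_le a1 ab ar _; exact: leq_trans n4.
  have -> : (damped_sum a_ n).[- x] =
      \sum_(k < n) (-1) ^+ k * t k + 2 / 3 * t n.
    rewrite horner_poly big_ord_recr /= eqxx; congr (_ + _).
      apply: eq_bigr => i _; rewrite ltn_eqF; last exact: ltn_ord.
      by rewrite (exprNn x) mulrCA.
    by rewrite (exprNn x) -signr_odd (negPf on) expr0 mul1r mulrA.
  by move: tn l0; lra.
have sgn k : exists s : R, (k.+2 <= n)%N ->
    term_ratio a_ k.+1 < s <= term_ratio a_ k.+2 /\
    0 < (-1) ^+ k.+2 * (damped_sum a_ n).[- s].
  have [kn|_] := leqP k.+2 n; last by exists 0.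
  by have [s s1 s2] := damped_sum_sign a3 ab key ar kn; exists s.
have [s sP] := choice sgn.
pose pt k := match k with 0 => 0 | 1 => x | k.+2 => s k end.
apply: (@negative_rooted_of_signs R _ n pt) => //.
- rewrite size_poly_eq// eqxx.
  by rewrite mulf_neq0// ?gt_eqF ?ar.1//; lra.
- move=> [|[|k]] kn //=.
    by have [/andP[h _] _] := sP 0%N kn; exact: le_lt_trans h.
  have [/andP[_ h] _] := sP k (ltnW kn).
  by have [/andP[h' _] _] := sP k.+1 kn; exact: le_lt_trans h'.
- move=> [|[|k]] kn /=.
  + by rewrite oppr0 p0 mul1r ar.1.
  + by rewrite expr1 mulN1r oppr_gt0.
  + by have [] := sP k kn.
Qed.

(** * Convergence of the damped sums, and the conclusion *)

(** [damped_sum a_ n] is the mean, with weights 1/3 and 2/3, of two consecutive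
    partial sums. *)
Lemma damped_sum_horner_cvg (R : realType) (a_ : nat -> R) (x l : R) :
  \sum_(k < n) a_ k * x ^+ k @[n --> \oo] --> l ->
  (damped_sum a_ n).[x] @[n --> \oo] --> l.
Proof.
move=> xl; pose s n := \sum_(k < n) a_ k * x ^+ k.
have xl1 : s n.+1 @[n --> \oo] --> l by rewrite -(cvg_shiftS s) in xl.
rewrite (_ : (fun n => _) = fun n => 1 / 3 * s n + 2 / 3 * s n.+1).
  have -> : l = 1 / 3 * l + 2 / 3 * l by field.
  by apply: cvgD; exact: cvgMr.
apply: funext => n; rewrite horner_poly big_ord_recr /= eqxx /s big_ord_recr /=.
rewrite (eq_bigr (fun k : 'I_n => a_ k * x ^+ k)); last first.
  by move=> k _; rewrite ltn_eqF.
by field.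
Qed.

Lemma damped_sum_coef_cvg (R : realType) (a_ : nat -> R) (k : nat) :
  (damped_sum a_ n)`_k @[n --> \oo] --> a_ k.
Proof.
apply: cvg_near_cst; exists k.+1 => // n /= kn.
by rewrite coef_poly ltnS ltnW// ltn_eqF.
Qed.

Lemma cvg_even_subseq : n.+2.*2 @[n --> \oo] --> \oo.
Proof. by move=> A [N _ NA]; exists N => // n /= Nn; apply: NA => /=; lia. Qed.

Theorem corollary1p3 (R : realType) (a_ : nat -> R) (f : R[i]^o -> R[i]^o)
    (a b : R)
    (a_gt0 : forall k : nat, 0 < a_ k)
    (f_entire : entire_with_coeffs a_ f)
    (a_gt1 : 1 < a) (a_lt_b : a < b)
    (q_even : forall m : nat, second_quotient a_ (m.*2 + 2)%N = a)
    (q_odd : forall m : nat, second_quotient a_ (m.*2 + 3)%N = b) :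
  (3 <= a -> a < 4 -> b <= 8 / (a * (4 - a)) ->
     exists z0 : R, - (a_ 1%N / a_ 2%N) <= z0 <= 0 /\ f z0%:C <= 0) /\
  ((exists z0 : R, - (a_ 1%N / a_ 2%N) <= z0 <= 0 /\ f z0%:C <= 0) ->
     multiplier_sequence (fun k : nat => (k`!)%:R * a_ k) /\
     complex_zero_decreasing_sequence (fun k : nat => complex.Re (f k%:R))).
Proof.
have ar := term_ratioP a_gt0 q_even q_odd.
split=> [a3 a4 b_le|[z0 [/andP[z0_ge z0_le]]]].
  exact: nonpos_of_quotients a3 a4 a_lt_b b_le ar f_entire.
rewrite lecE => /andP[_ /= fz0].
have phiN N : negative_rooted (damped_sum a_ N.+2.*2).
  apply: (damped_sum_negative_rooted (x := - z0)
    (l := complex.Re (f z0%:C)) a_gt1 a_lt_b ar) => //.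
  - by rewrite oppr_ge0 z0_le lerNl.
  - by have := @entire_neg_series _ _ _ (- z0) f_entire; rewrite opprK.
  - by rewrite odd_double.
split.
  apply: (@multiplier_of_lim R (fun N => damped_sum a_ N.+2.*2)) => // k.
  exact: (cvg_comp (fun n => n.+2.*2) (fun n => (damped_sum a_ n)`_k)
    cvg_even_subseq (@damped_sum_coef_cvg _ a_ k)).
have fk k : \sum_(i < n) a_ i * k%:R ^+ i @[n --> \oo] --> complex.Re (f k%:R).
  by have [+ _] := entire_real k%:R f_entire; rewrite rmorph_nat.
apply: (@czds_of_lim R (fun N => damped_sum a_ N.+2.*2)) => // k.
  exact: (cvg_comp (fun n => n.+2.*2) (fun n => (damped_sum a_ n).[k%:R])
    cvg_even_subseq (damped_sum_horner_cvg (fk k))).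
rewrite gt_eqF//; apply: lt_le_trans (a_gt0 0%N) _.
apply: (ler_cvg_to (cvg_cst (a_ 0%N)) (fk k)).
exists 1%N => // -[//|n] _ /=; rewrite big_ord_recl expr0 mulr1 lerDl.
by rewrite sumr_ge0// => i _; rewrite mulr_ge0 ?exprn_ge0// ltW.
Qed.
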